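(* Let $n\ge 1$ and let $\mathfrak{L}_1=S^{2n-1}/G_1$ and $\mathfrak{L}_2=S^{2n-1}/G_2$ be two lens spaces, with associated lattices $L_1,L_2\subset\mathbb{Z}^n$. Let $A$ be a generating matrix of $L_1$ and $B$ a generating matrix of $L_2$. Then $\mathfrak{L}_1$ and $\mathfrak{L}_2$ are isospectral if and only if the Ehrhart quasi-polynomials of $H_nA^{-1}$ and $H_nB^{-1}$ coincide, i.e. $I(A,m)=I(B,m)$ for every $m\in\mathbb{N}$.
   Context: Lens spaces: let $q$ be a positive integer and $p_1,\dots,p_n$ integers prime to $q$. Write $R(\theta)=\begin{pmatrix}\cos\theta&-\sin\theta\\ \sin\theta&\cos\theta\end{pmatrix}$ and let $G\subset O(2n)$ be the finite cyclic group generated by $g=R(2\pi p_1/q)\oplus\cdots\oplus R(2\pi p_n/q)$. It acts freely by isometries on the round unit sphere $S^{2n-1}$, and the quotient Riemannian manifold $S^{2n-1}/G$ is called a lens space. Two Riemannian manifolds are isospectral if their Laplace-Beltrami operators have the same spectrum, counting multiplicities. The lattice associated with the lens space $S^{2n-1}/G$ (given by $q,p_1,\dots,p_n$) is $L=\{(a_1,\dots,a_n)\in\mathbb{Z}^n : \sum_{j=1}^n a_jp_j\equiv 0 \pmod q\}$. A generating matrix of a full-rank lattice $L\subset\mathbb{Z}^n$ is a matrix $A$ whose columns form a $\mathbb{Z}$-basis of $L$. $H_n=\{x\in\mathbb{R}^n : |x_1|+\cdots+|x_n|\le 1\}$, and $H_nA^{-1}$ denotes the rational polytope that is the image $\{A^{-1}x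 : x\in H_n\}$ of $H_n$ under $A^{-1}$. For $k\in\mathbb{N}$, $I(A,k)$ is the cardinality of $k\,(H_nA^{-1})\cap\mathbb{Z}^n$; the function $k\mapsto I(A,k)$ is the Ehrhart quasi-polynomial of $H_nA^{-1}$. *)

(* Defs.v *)
From HB Require Import structures.
From mathcomp Require Import all_boot all_order all_algebra.
From mathcomp Require Import finmap.
From mathcomp Require Import all_classical all_reals all_analysis.

Set Implicit Arguments.
Unset Strict Implicit.
Unset Printing Implicit Defensive.

Import Order.TTheory GRing.Theory Num.Theory.
Import numFieldNormedType.Exports.

Local Open Scope classical_set_scope.
Local Open Scope ring_scope.

Section Sphere.
Variables (R : realType) (N : nat).

(* The library's norm `|x| on matrices is the sup norm. *)
Definition enorm (x : 'cV[R]_N) : R := Num.sqrt (\sum_i x i 0 ^+ 2).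

Definition sphere : set 'cV[R]_N := [set x | enorm x = 1].

Definition radial (x : 'cV[R]_N) : 'cV[R]_N := (enorm x)^-1 *: x.

Definition partial (i : 'I_N) (f : 'cV[R]_N -> R) : 'cV[R]_N -> R :=
  fun x => 'D_(delta_mx i 0) f x.

(* C^k on an open set U: the partial derivatives of order <= k exist and are
   continuous on U. *)
Fixpoint Ck (k : nat) (U : set 'cV[R]_N) (f : 'cV[R]_N -> R) : Prop :=
  match k with
  | 0 => forall x, U x -> {for x, continuous f}
  | k'.+1 => forall i,
      (forall x, U x -> derivable f x (delta_mx i 0)) /\ Ck k' U (partial i f)
  end.

(* A function on the sphere is represented by a function on R^N, of which only
   the values on the sphere matter.  Since [radial] is a smooth retraction of
   R^N \ {0} onto the sphere, f is the restriction of a smooth function defined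
   near the sphere if and only if f \o radial is smooth on R^N \ {0}. *)
Definition smooth_on_sphere (f : 'cV[R]_N -> R) : Prop :=
  forall k, Ck k [set x | x != 0] (f \o radial).

(* Riemannian gradient for the induced metric: f \o radial has zero radial
   derivative, so at a point of the sphere its Euclidean gradient is tangent to
   the sphere, and it represents df. *)
Definition grad_sphere (f : 'cV[R]_N -> R) : 'cV[R]_N -> 'cV[R]_N :=
  fun x => \col_i partial i (f \o radial) x.

(* Riemannian divergence of a tangent vector field X, i.e. the trace of the
   tangential part of the derivative of X along the sphere: X \o radial is an
   extension of X with zero radial derivative, so the full trace is the
   tangential one. *)
Definition div_sphere (X : 'cV[R]_N -> 'cV[R]_N) : 'cV[R]_N -> R :=
  fun x => \sum_i partial i (fun y => X (radial y) i 0) x.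

Definition laplace_sphere (f : 'cV[R]_N -> R) : 'cV[R]_N -> R :=
  div_sphere (grad_sphere f).

Variable G : set 'M[R]_N.

Definition orbit_of (x : 'cV[R]_N) : set 'cV[R]_N := [set g *m x | g in G].

(* The points of S^{N-1}/G are the G-orbits; [orbit_of] is the projection. *)
Definition sphere_quotient : set (set 'cV[R]_N) := [set orbit_of x | x in sphere].

(* Functions on S^{N-1}/G are functions on sets of vectors, of which only the
   values on [sphere_quotient] matter. When G is finite and acts freely by
   isometries, the smooth structure and the metric of S^{N-1}/G are the ones
   for which the projection is a local isometry. *)
Definition smooth_on_quotient (f : set 'cV[R]_N -> R) : Prop :=
  smooth_on_sphere (f \o orbit_of).

(* h is the Laplace-Beltrami operator of S^{N-1}/G (with the sign convention
   Delta = div grad) applied to f. *)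
Definition is_laplacian (f h : set 'cV[R]_N -> R) : Prop :=
  forall x, sphere x -> h (orbit_of x) = laplace_sphere (f \o orbit_of) x.

Definition eigenfunction (lambda : R) (f : set 'cV[R]_N -> R) : Prop :=
  smooth_on_quotient f /\ is_laplacian f (fun X => - (lambda * f X)).

(* lambda has multiplicity m: the lambda-eigenspace of -Delta has a basis of m
   functions (m = 0 when lambda is not an eigenvalue). *)
Definition has_multiplicity (lambda : R) (m : nat) : Prop :=
  exists b : 'I_m -> set 'cV[R]_N -> R,
    [/\ forall i, eigenfunction lambda (b i),
        forall c : 'I_m -> R,
          (forall X, sphere_quotient X -> \sum_i c i * b i X = 0) ->
          forall i, c i = 0
      & forall f, eigenfunction lambda f ->
          exists c : 'I_m -> R,
            forall X, sphere_quotient X -> f X = \sum_i c i * b i X].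

End Sphere.

(* On a compact manifold the spectrum consists of eigenvalues of finite
   multiplicity, so it is determined by the multiplicity of each real number. *)
Definition isospectral (R : realType) (N : nat) (G1 G2 : set 'M[R]_N) : Prop :=
  forall (lambda : R) (m : nat),
    has_multiplicity G1 lambda m <-> has_multiplicity G2 lambda m.

Section Lens.
Variables (R : realType) (n q : nat) (p : 'I_n -> int).

Definition rot2 (t : R) : 'M[R]_2 :=
  block_mx (cos t)%:M (- sin t)%:M (sin t)%:M (cos t)%:M : 'M[R]_(1 + 1).

(* R^{2n} is indexed by \sum_(j < n) 2, as in block-diagonal matrices. *)
Definition lens_generator : 'M[R]_(\sum_(j < n) 2) :=
  \mxdiag_(j < n) rot2 (2 * pi * (p j)%:~R / q%:R).

(* The generator has finite order when q > 0, so natural powers suffice. *)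
Definition lens_group : set 'M[R]_(\sum_(j < n) 2) :=
  [set lens_generator ^+ k | k in [set: nat]].

End Lens.

Arguments lens_generator R {n} q p.
Arguments lens_group R {n} q p.

Definition lens_lattice (n q : nat) (p : 'I_n -> int) : set 'cV[int]_n :=
  [set a : 'cV[int]_n | (\sum_j a j 0 * p j = 0 %[mod q%:Z])%Z].

Definition generating_matrix (n : nat) (L : set 'cV[int]_n) (A : 'M[int]_n) : Prop :=
  L = [set A *m c | c in [set: 'cV[int]_n]] /\
  (forall c : 'cV[int]_n, A *m c = 0 -> c = 0).

Definition cross_polytope (R : realType) (n : nat) : set 'cV[R]_n :=
  [set x : 'cV[R]_n | \sum_i `|x i 0| <= 1].
Arguments cross_polytope : clear implicits.

Definition lattice_polytope (R : realType) (n : nat) (A : 'M[int]_n) : set 'cV[R]_n :=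
  [set invmx (map_mx intr A) *m x | x in cross_polytope R n].
Arguments lattice_polytope R {n} A.

(* [fset_set] is only meaningful on finite sets; the set below is finite, as
   [lattice_polytope R A] is bounded. *)
Definition ehrhart (R : realType) (n : nat) (A : 'M[int]_n) (k : nat) : nat :=
  #|` fset_set [set z : 'cV[int]_n |
        [set k%:R *: x | x in lattice_polytope R A] (map_mx intr z)] |.

(* Main.v *)
(* Homogeneous functions.  A lambda-eigenfunction f of the sphere S^(N-1) extends to a function
   |x|^s f(x/|x|) on R^N \ {0}, homogeneous of degree s, which is harmonic when lambda = s (s+N-2).
   Partial derivatives of a harmonic function are harmonic, of degree lowered by one, and a harmonic
   function of degree strictly between 2-N and 0 vanishes: it is an eigenfunction of the sphere for a
   negative eigenvalue, which the second derivative test at a maximum forbids.  For N >= 4, going down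
   from s >= 0 to [-1,0) therefore shows that s is an integer k and, by Euler's identity, that the
   function is a homogeneous polynomial of degree k; the plane N = 2 needs the periodicity of the
   circle instead.  No integration is needed.

   Counting.  Write a homogeneous polynomial in the monomials z^a zbar^b with z_j = x_j + i y_j.  It is
   invariant under G when only the monomials with a - b in L occur, and it is harmonic when its
   coefficients satisfy a linear recursion whose solutions are freely determined by the coefficients
   with min(a_0, b_0) = 0.  Hence the eigenvalue k (k+2n-2) has as multiplicity the number of pairs (a,b) of
   total degree k with a - b in L and min(a_0, b_0) = 0.  Removing min(a,b) from a and b turns this
   number into sum_t c_t N_L(k-2t), where N_L(j) counts the vectors of L of 1-norm j and c_0 = 1: the
   multiplicities and the numbers N_L(j) determine each other, and the numbers N_L(j) are the successive
   differences of the Ehrhart function. *)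
From HB Require Import structures.
Require Import Defs.
From mathcomp Require Import all_boot all_order all_algebra.
From mathcomp Require Import finmap.
From mathcomp Require Import all_classical all_reals all_analysis.
From mathcomp Require Import complex.
From mathcomp Require Import ring lra zify.

Set Implicit Arguments.
Unset Strict Implicit.
Unset Printing Implicit Defensive.

Import Order.TTheory GRing.Theory Num.Theory.
Import numFieldNormedType.Exports.

Local Open Scope classical_set_scope.
Local Open Scope ring_scope.

(** * Calculus in several variables *)

Section Calculus.
Variables (R : realType) (N : nat).
Local Notation V := 'cV[R]_N.
Local Notation e_ i := (delta_mx i 0 : V).
Implicit Types (f g u : V -> R) (x y v : V) (U : set V).

(** Smoothness is stated through iterated partial derivatives, so differentiability and the symmetry
    of second derivatives are derived from mean values on segments; Euler's identity and the descent
    by differentiation rest on them. The descent ends with a gradient of degree in [[-1,0)], above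
    [2 - N] as soon as [N >= 4]; since [N = 2 n] is even, only the plane escapes. A non-integral
    degree dies there because a homogeneous function of nonzero degree with zero gradient is zero.

    Eigenfunctions are real whereas [z^a zbar^b] is complex. Replacing a monomial [w] by
    [Re w + Im w] gives one real function per exponent, so real multiplicities are counted by
    exponents without grouping conjugate pairs.

    Singling out the index 0 avoids splitting polynomials into harmonic ones and multiples of
    [|x|^2]: the harmonic equation at a monomial [m] is solved for the coefficient of
    [z_0 zbar_0 m], and this recursion preserves [a - b], hence is compatible with invariance under
    G. The constant [c_t] is the number of ways to distribute [t] common factors [z_j zbar_j] over
    the indices [j] other than 0. *)

Lemma is_derive_line f x v (t d : R) :
  is_derive (t *: v + x) v f d -> is_derive t 1 (fun s => f (s *: v + x)) d.
Proof.
move=> [df <-].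
have E : (fun h : R => h^-1 *: (((fun s => f (s *: v + x)) \o shift t) (h *: 1) - f (t *: v + x)))
   = (fun h : R => h^-1 *: ((f \o shift (t *: v + x)) (h *: v) - f (t *: v + x))).
  by apply/funext => h /=; rewrite [h *: 1]mulr1 scalerDl addrA.
by split; [rewrite /derivable E | rewrite /derive E].
Qed.

Lemma is_derive_line_inv f x v (t d : R) :
  is_derive t 1 (fun s => f (s *: v + x)) d -> is_derive (t *: v + x) v f d.
Proof.
move=> [df <-].
have E : (fun h : R => h^-1 *: (((fun s => f (s *: v + x)) \o shift t) (h *: 1) - f (t *: v + x)))
   = (fun h : R => h^-1 *: ((f \o shift (t *: v + x)) (h *: v) - f (t *: v + x))).
  by apply/funext => h /=; rewrite [h *: 1]mulr1 scalerDl addrA.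
by move: df; rewrite /derivable E => df; split => //; rewrite /derive E.
Qed.

Lemma is_derive_scale f x v (c d : R) :
  is_derive x v f d -> is_derive x (c *: v) f (c * d).
Proof.
move=> dfx; rewrite -(add0r x) -(scale0r (c *: v)); apply: is_derive_line_inv.
have -> : (fun s : R => f (s *: (c *: v) + x)) =
   (fun s => f (s *: v + x)) \o (fun s => c * s).
  by apply/funext => s /=; rewrite scalerA mulrC.
have h0 : is_derive (c * 0) 1 (fun s => f (s *: v + x)) d.
  by apply: is_derive_line; rewrite mulr0 scale0r add0r.
have h1 : is_derive (0 : R) 1 (fun s => c * s) c.
  by apply: is_derive_eq; rewrite [LHS]mulr1.
by rewrite mulrC; apply: is_derive1_comp.
Qed.

Lemma MVT_line f x v :
  (forall t : R, 0 <= t <= 1 -> derivable f (t *: v + x) v) ->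
  exists2 t : R, 0 < t < 1 & f (v + x) - f x = 'D_v f (t *: v + x).
Proof.
move=> df.
pose g (t : R) := f (t *: v + x).
have dg (t : R) : 0 <= t <= 1 -> is_derive t (1:R) g ('D_v f (t *: v + x)).
  by move=> t01; apply: is_derive_line; apply/derivableP/df.
have cg : {within `[0, 1], continuous g}.
  apply: derivable_within_continuous => t; rewrite in_itv /= => t01.
  by have [] := dg t t01.
have [|c c01 E] := @MVT R g (fun t => 'D_v f (t *: v + x)) 0 1 ltr01 _ cg.
  move=> t; rewrite in_itv /= => /andP[t0 t1]; apply: dg.
  by rewrite !ltW.
exists c; first by move: c01; rewrite in_itv.
by move: E; rewrite /g scale1r scale0r add0r subr0 mulr1.
Qed.

Lemma MVT_coord f x i (c : R) :
  (forall t : R, 0 <= t <= 1 -> derivable f ((t * c) *: e_ i + x) (e_ i)) ->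
  exists2 t : R, 0 < t < 1 &
    f (c *: e_ i + x) - f x = c * partial i f ((t * c) *: e_ i + x).
Proof.
move=> df.
have dc (t : R) : 0 <= t <= 1 ->
   is_derive (t *: (c *: e_ i) + x) (c *: e_ i) f (c * partial i f ((t * c) *: e_ i + x)).
  by move=> t01; rewrite scalerA; apply/is_derive_scale/derivableP/df.
have [|t t01 E] := @MVT_line f x (c *: e_ i).
  by move=> t t01; have [] := dc t t01.
exists t => //; have /andP[/ltW t0 /ltW t1] := t01.
have t01' : 0 <= t <= 1 by rewrite t0 t1.
by rewrite E; have [_ ->] := dc t t01'.
Qed.


Definition lincomb (c : 'I_N -> R) (v : V) : R := \sum_i v i 0 * c i.

Lemma lincomb_is_linear c : linear (lincomb c).
Proof.
move=> a v w; rewrite /lincomb scaler_sumr -big_split; apply: eq_bigr => i _ /=.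
by rewrite !mxE mulrDl -mulrA.
Qed.

HB.instance Definition _ c := GRing.isLinear.Build R V R _ (lincomb c) (lincomb_is_linear c).

Lemma lincomb_continuous c : continuous (lincomb c).
Proof.
rewrite /lincomb; apply: continuous_big => [|i _ v]; first exact: add_continuous.
have ci := @coord_continuous R N 1 i 0 v.
by apply: continuousM => //; exact: cst_continuous.
Qed.

(** A staircase from 0 to [v]: consecutive values of [m] differ in one coordinate, so the mean value
    theorem applies to each step. *)
Definition keep_coords (m : nat) (v : V) : V := \col_i (if (i < m)%N then v i 0 else 0).

Lemma mx_norm_coord v i : `|v i 0| <= `|v|.
Proof. by rewrite [leRHS]/Num.Def.normr/= mx_normrE; exact: (le_bigmax _ _ (i, 0)). Qed.

(** Each step of the staircase from [x] to [x + h] is governed by a partial derivative at a nearby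
    point, which continuity compares with its value at [x]. *)
Lemma C1_is_diff f x U : open U -> U x ->
  (forall i y, U y -> derivable f y (e_ i)) ->
  (forall i, {for x, continuous (partial i f)}) ->
  is_diff x f (lincomb (fun i => partial i f x)).
Proof.
move=> oU Ux df cf; pose L := lincomb (fun i => partial i f x).
have Lc : continuous L by exact: lincomb_continuous.
pose W : normedModType R := R.
suff E : (f : V -> W) \o shift x = cst (f x : W) + (L : V -> W) +o_ (0 : V) id.
  have dfx := @diff_unique R V W f (lincomb (fun i => partial i f x)) x Lc E; split => //.
  by apply/diff_locallyP; rewrite dfx.
apply/eqaddoP => _/posnumP[eps].
(* The N steps contribute an error of at most [eta * |h|] each; dividing by [N + 1] also covers
   [N = 0]. *)
pose eta := eps%:num / N.+1%:R.
have eta0 : 0 < eta by rewrite divr_gt0.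
have : \forall y \near x, U y /\ forall i, `|partial i f x - partial i f y| <= eta.
  apply: filterI; first exact: open_nbhs_nbhs.
  have cfe i : \forall y \near x, `|partial i f x - partial i f y| <= eta.
    by have /cvgrPdist_le /(_ _ eta0) := cf i.
  exact: (@filter_forall V _ _ (nbhs x) _ cfe).
move=> /nbhs_ballP[d /= d0 Hd].
apply/nbhs_ballP; exists d => // h; rewrite mx_norm_ball /ball_ /= sub0r normrN => hd.
have key m : (m <= N)%N ->
  `|f (keep_coords m h + x) - f x - \sum_(i < N | (i < m)%N) h i 0 * partial i f x|
     <= m%:R * (eta * `|h|).
  elim: m => [|m IH] mN.
    rewrite big_pred0 // subr0 mul0r.
    have -> : keep_coords 0 h = 0 by apply/colP => i; rewrite !mxE.
    by rewrite add0r subrr normr0.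
  pose i0 := Ordinal mN.
  have trS : keep_coords m.+1 h + x = h i0 0 *: e_ i0 + (keep_coords m h + x).
    rewrite addrA; congr (_ + _); apply/colP => i; rewrite !mxE eqxx andbT.
    have [->|ii0] := eqVneq i i0; first by rewrite /= ltnSn ltnn mulr1 addr0.
    have im : (i : nat) <> m by move=> im; move/eqP: ii0; apply; exact: val_inj.
    by rewrite mulr0 add0r ltnS leq_eqVlt; case: eqP im.
  have inb (t : R) : 0 <= t <= 1 ->
      let y := (t * h i0 0) *: e_ i0 + (keep_coords m h + x) in
      U y /\ forall i, `|partial i f x - partial i f y| <= eta.
    move=> /andP[t0 t1] y; apply: Hd; rewrite mx_norm_ball /ball_ /= (le_lt_trans _ hd) //.
    rewrite [leLHS]/Num.Def.normr/= mx_normrE; apply: bigmax_le => // -[i j] _.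
    rewrite !mxE /= ord1 eqxx andbT.
    have [->|ii0] := eqVneq i i0.
      rewrite /= ltnn mulr1 add0r opprD addrCA subrr addr0 normrN normrM (ger0_norm t0).
      by rewrite (le_trans _ (mx_norm_coord _ i0)) // ler_piMl.
    rewrite mulr0 add0r opprD addrCA subrr addr0 normrN.
    by case: ifP => _; rewrite ?normr0 // mx_norm_coord.
  have [|t /andP[t0' t1'] E] := @MVT_coord f (keep_coords m h + x) i0 (h i0 0).
    by move=> t t01; apply: df; have [] := inb t t01.
  have t01 : 0 <= t <= 1 by rewrite !ltW.
  have [_ /(_ i0) Hi0] := inb t t01.
  rewrite trS (bigD1 i0) //=.
  rewrite (eq_bigl (fun i : 'I_N => (i < m)%N)); last first.
    move=> i /=; rewrite ltnS leq_eqVlt; have [->|ii0] := eqVneq i i0.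
      by rewrite /= ltnn andbF.
    have im : (i : nat) <> m by move=> im; move/eqP: ii0; apply; exact: val_inj.
    by rewrite andbT; case: eqP im.
  set S := \sum_(i < N | _) _.
  have -> : f (h i0 0 *: e_ i0 + (keep_coords m h + x)) - f x - (h i0 0 * partial i0 f x + S)
     = h i0 0 * (partial i0 f ((t * h i0 0) *: e_ i0 + (keep_coords m h + x)) - partial i0 f x)
       + (f (keep_coords m h + x) - f x - S).
    by rewrite mulrBr -E; ring.
  rewrite (le_trans (ler_normD _ _)) // -natr1 mulrDl mul1r addrC lerD ?IH ?(ltnW mN) //.
  by rewrite normrM mulrC ler_pM // ?mx_norm_coord // distrC.
have -> : (f \o shift x - (cst (f x) + L)) h =
   f (keep_coords N h + x) - f x - \sum_(i < N | (i < N)%N) h i 0 * partial i f x.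
  have -> : keep_coords N h = h by apply/colP => i; rewrite mxE ltn_ord.
  rewrite /L /lincomb; under [in RHS]eq_bigl do rewrite ltn_ord.
  by rewrite -addrA -opprD.
rewrite (le_trans (key N (leqnn N))) // mulrA ler_wpM2r // /eta mulrCA.
by rewrite ler_piMr // ler_pdivrMr // mul1r ler_nat.
Qed.

End Calculus.

(** * Algebra of smooth functions and symmetry of second derivatives *)

Section Smooth.
Variables (R : realType) (N : nat).
Local Notation V := 'cV[R]_N.
Local Notation e_ i := (delta_mx i 0 : V).
Implicit Types (f g u : V -> R) (x y v : V).
Variables (U : set V) (oU : open U).

Lemma near_open x (P : V -> Prop) : U x -> (forall y, U y -> P y) -> \forall y \near x, P y.
Proof.
move=> Ux UP; have : nbhs x U by exact: open_nbhs_nbhs.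
exact: filterS.
Qed.

Lemma partial_ext i f g x : U x -> (forall y, U y -> f y = g y) ->
  partial i f x = partial i g x.
Proof. by move=> Ux fg; apply: near_eq_derive; exact: near_open. Qed.

Lemma Ck_ext k f g : (forall x, U x -> f x = g x) -> Ck k U f -> Ck k U g.
Proof.
elim: k f g => [|k IH] f g fg /=.
  move=> cf x Ux; have cfx : f @ x --> f x by exact: cf.
  suff : g @ x --> g x by [].
  rewrite -fg //; apply: cvg_trans cfx; apply: (@near_eq_cvg V R (nbhs x)).
  exact: near_open.
move=> Hf i; have [df Cf] := Hf i; split.
  move=> x Ux; apply: near_eq_derivable (df x Ux); exact: near_open.
by apply: IH Cf => x Ux; exact: partial_ext.
Qed.

Lemma C1_diff f x : Ck 1 U f -> U x ->
  is_diff x f (lincomb (fun i => partial i f x)).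
Proof.
move=> Cf Ux; apply: (@C1_is_diff _ _ _ _ U) => // i; first by case: (Cf i).
by have [_ /(_ x Ux)] := Cf i.
Qed.

(** Partial derivatives alone do not give continuity: passing from order 1 to order 0 uses the
    differentiability of C^1 functions. *)
Lemma Ck_pred k f : Ck k.+1 U f -> Ck k U f.
Proof.
elim: k f => [|k IH] f Cf.
  by move=> x Ux; have [d _] := C1_diff Cf Ux; exact: differentiable_continuous.
by move=> i; have [df Cfi] := Cf i; split => //; exact: IH.
Qed.

Lemma partialD i f g x : derivable f x (e_ i) -> derivable g x (e_ i) ->
  partial i (f \+ g) x = partial i f x + partial i g x.
Proof. by move=> df dg; exact: (@deriveD R V R f g x (e_ i) df dg). Qed.

Lemma partialM i f g x : derivable f x (e_ i) -> derivable g x (e_ i) ->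
  partial i (f \* g) x = f x * partial i g x + g x * partial i f x.
Proof. by move=> df dg; exact: (@deriveM R V f g x (e_ i) df dg). Qed.

Lemma Ck_add k f g : Ck k U f -> Ck k U g -> Ck k U (f \+ g).
Proof.
elim: k f g => [|k IH] f g Cf Cg.
  by move=> x Ux; apply: continuousD; [exact: Cf | exact: Cg].
move=> i; have [df Cf'] := Cf i; have [dg Cg'] := Cg i; split.
  by move=> x Ux; apply: derivableD; [exact: df | exact: dg].
apply: Ck_ext (IH _ _ Cf' Cg') => x Ux /=.
by rewrite partialD //; [exact: df | exact: dg].
Qed.

Lemma Ck_mul k f g : Ck k U f -> Ck k U g -> Ck k U (f \* g).
Proof.
elim: k f g => [|k IH] f g Cf Cg.
  by move=> x Ux; apply: continuousM; [exact: Cf | exact: Cg].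
move=> i; have [df Cf'] := Cf i; have [dg Cg'] := Cg i; split.
  by move=> x Ux; apply: derivableM; [exact: df | exact: dg].
have C1 := IH _ _ (Ck_pred Cf) Cg'; have C2 := IH _ _ (Ck_pred Cg) Cf'.
apply: Ck_ext (Ck_add C1 C2) => x Ux /=.
by rewrite partialM //; [exact: df | exact: dg].
Qed.

Definition smooth f := forall k, Ck k U f.

Lemma partial_cst i (c : R) x : partial i (cst c) x = 0.
Proof. by rewrite /partial derive_cst. Qed.

Lemma smooth_cst (c : R) : smooth (cst c).
Proof.
move=> k; elim: k c => [|k IH] c; first by move=> x _; exact: cst_continuous.
move=> i; split; first by move=> x _; exact: derivable_cst.
by have -> : partial i (cst c) = cst 0 by apply/funext => x; rewrite partial_cst.
Qed.

Lemma smooth_ext f g : (forall x, U x -> f x = g x) -> smooth f -> smooth g.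
Proof. by move=> fg sf k; exact: Ck_ext (sf k). Qed.

Lemma smooth_add f g : smooth f -> smooth g -> smooth (f \+ g).
Proof. by move=> sf sg k; exact: Ck_add. Qed.

Lemma smooth_mul f g : smooth f -> smooth g -> smooth (f \* g).
Proof. by move=> sf sg k; exact: Ck_mul. Qed.

Lemma smooth_scale c f : smooth f -> smooth (fun x => c * f x).
Proof. by move=> sf; exact: (smooth_mul (smooth_cst c) sf). Qed.

Lemma smooth_sum (I : Type) (r : seq I) (P : pred I) (F : I -> V -> R) :
  (forall i, smooth (F i)) -> smooth (fun x => \sum_(i <- r | P i) F i x).
Proof.
move=> sF; elim: r => [|a r IH].
  by have -> : (fun x => \sum_(i <- [::] | P i) F i x) = cst 0;
    [apply/funext => x; rewrite big_nil | exact: smooth_cst].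
have [Pa|nPa] := boolP (P a).
  have -> : (fun x => \sum_(i <- a :: r | P i) F i x) =
     F a \+ (fun x => \sum_(i <- r | P i) F i x).
    by apply/funext => x; rewrite big_cons Pa.
  exact: smooth_add.
have -> : (fun x => \sum_(i <- a :: r | P i) F i x) = (fun x => \sum_(i <- r | P i) F i x).
  by apply/funext => x; rewrite big_cons (negbTE nPa).
exact: IH.
Qed.

Lemma smooth_partial i f : smooth f -> smooth (partial i f).
Proof. by move=> sf k; have [] := sf k.+1 i. Qed.

Lemma smooth_derivable i f x : smooth f -> U x -> derivable f x (e_ i).
Proof. by move=> sf Ux; have [/(_ x Ux)] := sf 1 i. Qed.

Lemma smooth_continuous f x : smooth f -> U x -> {for x, continuous f}.
Proof. by move=> sf; exact: (sf 0). Qed.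

Lemma smooth_diff f x : smooth f -> U x ->
  is_diff x f (lincomb (fun i => partial i f x)).
Proof. by move=> sf Ux; exact: C1_diff. Qed.

Lemma derive_coord x v j : is_derive x v (fun y : V => y j 0) (v j 0).
Proof.
have E : (fun h : R => h^-1 *: (((fun y : V => y j 0) \o shift x) (h *: v) - x j 0)) @ 0^' --> v j 0.
  apply: (@cvg_trans _ ((cst (v j 0)) @ (0:R)^')); last exact: cvg_cst.
  apply: near_eq_cvg; near=> h.
  by rewrite /= !mxE addrK scalerA mulVf ?scale1r //; near: h; exact: nbhs_dnbhs_neq.
split; first by apply/cvg_ex; exists (v j 0).
exact: cvg_lim E.
Unshelve. all: by end_near. Qed.

Lemma partial_coord i j x : partial i (fun y => y j 0) x = (j == i)%:R.
Proof. by have [_ E] := derive_coord x (e_ i) j; rewrite /partial E mxE eqxx andbT. Qed.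

Lemma smooth_coord j : smooth (fun y => y j 0).
Proof.
case=> [|k]; first by move=> x _; exact: coord_continuous.
move=> i; split; first by move=> x _; have [] := derive_coord x (e_ i) j.
have -> : partial i (fun y : V => y j 0) = cst (j == i)%:R.
  by apply/funext => x; rewrite partial_coord.
exact: smooth_cst.
Qed.

Lemma partial_sum i (I : Type) (r : seq I) (P : pred I) (F : I -> V -> R) x :
  U x -> (forall i, smooth (F i)) ->
  partial i (fun x => \sum_(j <- r | P j) F j x) x = \sum_(j <- r | P j) partial i (F j) x.
Proof.
move=> Ux sF; elim: r => [|a r IH].
  have -> : (fun x => \sum_(j <- [::] | P j) F j x) = cst 0.
    by apply/funext => y; rewrite big_nil.
  by rewrite partial_cst big_nil.
rewrite big_cons -IH; case: ifP => Pa.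
  have -> : (fun x => \sum_(j <- a :: r | P j) F j x) =
     F a \+ (fun x => \sum_(j <- r | P j) F j x).
    by apply/funext => y; rewrite big_cons Pa.
  rewrite partialD //; first exact: smooth_derivable.
  by apply: smooth_derivable => //; exact: smooth_sum.
by congr partial; apply/funext => y; rewrite big_cons Pa.
Qed.

Lemma partial_scale i c f x : U x -> smooth f -> partial i (fun x => c * f x) x = c * partial i f x.
Proof.
move=> Ux sf; have -> : (fun x => c * f x) = cst c \* f by [].
rewrite partialM; [| exact: derivable_cst | exact: smooth_derivable].
by rewrite partial_cst mulr0 addr0.
Qed.

(** The mean value theorem in direction [i] is applied to the increment of [f] in direction [j], and
    then in direction [j] to [partial i f]. The condition [2 * h < d] keeps the square of side [h]
    inside the ball. *)
Lemma double_difference i j f x (d h : R) : smooth f -> 0 < h -> 2 * h < d ->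
  (forall y, `|y - x| < d -> U y) ->
  exists2 y, `|y - x| < d &
    f (h *: e_ i + (h *: e_ j + x)) - f (h *: e_ i + x) - (f (h *: e_ j + x) - f x)
      = h ^+ 2 * partial j (partial i f) y.
Proof.
move=> sf h0 hd Ud.
have small (t s : R) : 0 <= t <= 1 -> 0 <= s <= 1 ->
    `|(t * h) *: e_ i + ((s * h) *: e_ j + x) - x| < d.
  move=> /andP[t0 t1] /andP[s0 s1]; rewrite addrA addrK.
  have ne k : `|e_ k| <= 1.
    rewrite /Num.Def.normr /= mx_normrE; apply: bigmax_le => // -[a b] _.
    by rewrite mxE; case: (_ && _); rewrite ?normr1 ?normr0.
  have bnd (r : R) k : 0 <= r -> r <= 1 -> `|(r * h) *: e_ k| <= h.
    move=> r0 r1; have h0' := ltW h0.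
    rewrite normrZ (ger0_norm (mulr_ge0 r0 h0')) -mulrA -[leRHS]mul1r.
    by apply: ler_pM => //; rewrite ?mulr_ge0 // ler_piMr.
  apply: le_lt_trans hd; apply: le_trans (ler_normD _ _) _.
  by rewrite mulrDl mul1r lerD ?bnd.
pose g y := f (h *: e_ j + y) - f y.
have dshift y : U (h *: e_ j + y) ->
    is_derive y (e_ i) (fun y => f (h *: e_ j + y)) (partial i f (h *: e_ j + y)).
  move=> Uy; have [D _] : is_derive (h *: e_ j + y) (e_ i) f (partial i f (h *: e_ j + y)).
    by apply/derivableP/smooth_derivable.
  have E : (fun k : R => k^-1 *: (((fun y => f (h *: e_ j + y)) \o shift y) (k *: e_ i)
       - f (h *: e_ j + y))) = (fun k : R => k^-1 *: ((f \o shift (h *: e_ j + y)) (k *: e_ i)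
       - f (h *: e_ j + y))).
    by apply/funext => k /=; rewrite addrCA.
  by split; [rewrite /derivable E | rewrite /derive E].
have dg y : U (h *: e_ j + y) -> U y ->
    is_derive y (e_ i) g (partial i f (h *: e_ j + y) - partial i f y).
  move=> U1 U2; have D1 := dshift y U1.
  have D2 : is_derive y (e_ i) f (partial i f y) by apply/derivableP/smooth_derivable.
  exact: is_deriveB.
have in1 (t : R) : 0 <= t <= 1 -> U (h *: e_ j + ((t * h) *: e_ i + x)).
  by move=> t01; apply: Ud; rewrite addrCA -[h in h *: e_ j]mul1r small // ler01 lexx.
have in0 (t : R) : 0 <= t <= 1 -> U ((t * h) *: e_ i + x).
  move=> t01; apply: Ud; have := small t 0 t01; rewrite mul0r scale0r add0r; apply.
  by rewrite lexx ler01.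
have [|t /andP[t0 t1] E] := @MVT_coord _ _ g x i h.
  by move=> t t01; have [] := dg _ (in1 t t01) (in0 t t01).
have t01 : 0 <= t <= 1 by rewrite !ltW.
have E2 : partial i g _ = _ := @derive_val _ _ _ _ _ _ _ (dg _ (in1 t t01) (in0 t t01)).
have spf := smooth_partial i sf.
have [|s /andP[s0 s1] E3] := @MVT_coord _ _ (partial i f) ((t * h) *: e_ i + x) j h.
  move=> s s01; apply: smooth_derivable => //; apply: Ud.
  by rewrite addrCA small.
have s01 : 0 <= s <= 1 by rewrite !ltW.
exists ((s * h) *: e_ j + ((t * h) *: e_ i + x)); first by rewrite addrCA small.
rewrite expr2 -mulrA -E3 -E2 -E /g.
by congr (_ - _ - _); rewrite addrCA.
Qed.

Fact sub4AC (a b c d : R) : a - b - (c - d) = a - c - (b - d).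
Proof. by ring. Qed.

Fact dist_half (a b c e : R) : `|a - c| <= e / 2 -> `|b - c| <= e / 2 -> `|a - b| <= e.
Proof.
rewrite !ler_norml => /andP[? ?] /andP[? ?].
by apply/andP; split; lra.
Qed.

(** The second difference is symmetric in [i] and [j], so one mixed derivative at a point near [x]
    equals the other one at another such point; continuity at [x] concludes. *)
Lemma schwarz i j f x : smooth f -> U x ->
  partial i (partial j f) x = partial j (partial i f) x.
Proof.
move=> sf Ux.
have sij := smooth_partial i (smooth_partial j sf).
have sji := smooth_partial j (smooth_partial i sf).
apply/eqP; rewrite -subr_eq0 -normr_eq0 eq_le normr_ge0 andbT.
apply/ler_addgt0Pl => eps eps0; rewrite addr0.
have e20 : 0 < eps / 2 by rewrite divr_gt0.
have h1 : \forall y \near x, U y by exact: near_open.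
have /cvgrPdist_le /(_ _ e20) h2 := smooth_continuous sij Ux.
have /cvgrPdist_le /(_ _ e20) h3 := smooth_continuous sji Ux.
have [d /= d0 Hd] := (nbhs_ballP _ _).1 (filterI h1 (filterI h2 h3)).
have {}Hd y : `|y - x| < d -> [/\ U y,
    `|partial i (partial j f) x - partial i (partial j f) y| <= eps / 2 &
    `|partial j (partial i f) x - partial j (partial i f) y| <= eps / 2].
  by move=> yd; have [|H1 [H2 H3]] := Hd y; [rewrite mx_norm_ball /ball_ /= distrC | exact: And3 H1 H2 H3].
pose h := d / 3.
have h0 : 0 < h by rewrite divr_gt0.
have hd : 2 * h < d by rewrite /h; lra.
have Ud y : `|y - x| < d -> U y by case/Hd.
have [y yd E1] := @double_difference i j f x d h sf h0 hd Ud.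
have [z zd E2] := @double_difference j i f x d h sf h0 hd Ud.
have E : partial j (partial i f) y = partial i (partial j f) z.
  apply: (@mulfI _ (h ^+ 2)); first by rewrite expf_neq0 // gt_eqF.
  apply: etrans (esym E1) _; apply: etrans _ E2; rewrite [h *: e_ i + (_ + x)]addrCA.
  exact: sub4AC.
have [_ _ B1] := Hd y yd; have [_ B2 _] := Hd z zd.
rewrite E in B1; exact: (dist_half B2 B1).
Qed.

End Smooth.
Arguments smooth_derivable {R N U i f x} _ _.

(** * Homogeneous harmonic functions *)

Section Homogeneous.
Variables (R : realType) (N : nat).
Local Notation V := 'cV[R]_N.
Local Notation e_ i := (delta_mx i 0 : V).
Implicit Types (f g u : V -> R) (x y v : V).

Definition punctured : set V := [set x | x != 0].

Lemma punctured_open : open punctured.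
Proof.
have -> : punctured = ~` [set 0].
  by apply/seteqP; split => x /= /eqP.
exact/closed_openC/accessible_closed_set1/hausdorff_accessible/norm_hausdorff.
Qed.
Hint Resolve punctured_open : core.

Definition homog (d : R) f := forall (t : R) x, 0 < t -> x != 0 -> f (t *: x) = t `^ d * f x.

Lemma is_derive_chain (phi : R -> R) f x v (a b : R) :
  is_derive (f x) 1 phi a -> is_derive x v f b -> is_derive x v (phi \o f) (a * b).
Proof.
move=> Dphi Df; rewrite -[x]add0r -(scale0r v); apply: is_derive_line_inv.
apply: (@is_derive1_comp _ phi (fun s => f (s *: v + x))).
  by rewrite scale0r add0r.
by apply: is_derive_line; rewrite scale0r add0r.
Qed.

Lemma partial_is_derive i f x : smooth punctured f -> x != 0 ->
  is_derive x (e_ i) f (partial i f x).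
Proof. move=> sf x0; exact: (derivableP (smooth_derivable sf x0)). Qed.

Lemma powR_sub1 (t d : R) : 0 < t -> t `^ (d - 1) = t `^ d * t^-1.
Proof.
move=> t0; rewrite powRD; last by rewrite (gt_eqF t0) implybT.
by rewrite powR_inv1 // ltW.
Qed.

Lemma partial_homog i d f : smooth punctured f -> homog d f -> homog (d - 1) (partial i f).
Proof.
move=> sf hf t x t0 x0.
have tn0 : t != 0 by rewrite gt_eqF.
have Df := partial_is_derive i sf x0.
have D1 : is_derive (t *: x) (e_ i) (fun y => f (t^-1 *: y)) (t^-1 * partial i f x).
  have [D E] : is_derive x (t^-1 *: e_ i) f (t^-1 * partial i f x) by exact: is_derive_scale.
  have Q : (fun h : R => h^-1 *: (((fun y => f (t^-1 *: y)) \o shift (t *: x)) (h *: e_ i) -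
        f (t^-1 *: (t *: x)))) =
      (fun h : R => h^-1 *: ((f \o shift x) (h *: (t^-1 *: e_ i)) - f x)).
    have tK y : t^-1 *: (t *: y) = y by rewrite scalerA mulVf // scale1r.
    apply/funext => h /=.
    have -> : t^-1 *: (h *: e_ i + t *: x) = h *: (t^-1 *: e_ i) + x.
      by rewrite scalerDr tK !scalerA mulrC.
    by rewrite tK.
  by split; [rewrite /derivable Q | rewrite /derive Q].
have D2 : is_derive (t *: x) (e_ i) (fun y => t `^ d * f (t^-1 *: y)) (t `^ d * (t^-1 * partial i f x)).
  exact: (@is_deriveZ R V R (fun y => f (t^-1 *: y)) (t `^ d)).
have tx0 : t *: x != 0 by rewrite scaler_eq0 negb_or tn0.
have -> : partial i f (t *: x) = partial i (fun y => t `^ d * f (t^-1 *: y)) (t *: x).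
  apply: (partial_ext punctured_open) => // y y0.
  by rewrite -hf ?scaler_eq0 ?negb_or ?invr_eq0 ?tn0 // scalerA divff // scale1r.
by rewrite powR_sub1 // -mulrA; exact: derive_val.
Qed.

(** Both sides are the derivative of [t |-> f (t *: x)] at [t = 1]. *)
Lemma euler d f x : smooth punctured f -> homog d f -> x != 0 ->
  \sum_i x i 0 * partial i f x = d * f x.
Proof.
move=> sf hf x0.
have [Df E] := smooth_diff punctured_open sf (x0 : punctured x).
have <- : 'D_x f x = \sum_i x i 0 * partial i f x by rewrite deriveE // E.
have D1 : is_derive (1 *: x + 0) x f ('D_x f x).
  by rewrite scale1r addr0; apply: derivableP; exact: diff_derivable.
have {}D1 := is_derive_line D1.
have D2 : is_derive (1 : R) (1 : R) (fun t => f x * t `^ d) (f x * (d * 1 `^ (d - 1))).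
  have D : is_derive (1 : R) (1 : R) (fun t => t `^ d) (d * 1 `^ (d - 1)).
    exact: is_derive1_powR.
  exact: (@is_deriveZ R R R (fun t => t `^ d) (f x)).
have D3 : is_derive (1 : R) (1 : R) (fun t => f (t *: x + 0)) (f x * (d * 1 `^ (d - 1))).
  apply: near_eq_is_derive D2; near=> t.
  by rewrite addr0 hf 1?mulrC //; near: t; exact: lt_nbhsr.
by rewrite -(@derive_val _ _ _ _ _ _ _ D1) (@derive_val _ _ _ _ _ _ _ D3) powR1 mulr1 mulrC.
Unshelve. all: by end_near. Qed.

Definition sqn x : R := \sum_i x i 0 ^+ 2.

Lemma sqn_ge0 x : 0 <= sqn x.
Proof. by apply: sumr_ge0 => i _; exact: sqr_ge0. Qed.

Lemma sqn_eq0 x : sqn x = 0 -> x = 0.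
Proof.
move=> q0; apply/colP => i; rewrite mxE; apply/eqP; rewrite -sqrf_eq0; apply/eqP.
by apply: (psumr_eq0P _ q0) => // j _; exact: sqr_ge0.
Qed.

Lemma sqn_gt0 x : x != 0 -> 0 < sqn x.
Proof.
move=> x0; rewrite lt_def sqn_ge0 andbT; apply: contra x0 => /eqP q0; apply/eqP.
exact: sqn_eq0.
Qed.

Lemma sqnZ (t : R) x : sqn (t *: x) = t ^+ 2 * sqn x.
Proof. by rewrite /sqn mulr_sumr; apply: eq_bigr => i _; rewrite mxE exprMn. Qed.

Lemma sqn_smooth : smooth punctured sqn.
Proof.
have sc i : smooth punctured (fun x : V => x i 0).
  exact: smooth_coord.
apply: (smooth_sum punctured_open) => i.
exact: (smooth_mul punctured_open (sc i) (sc i)).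
Qed.

Lemma partial_sqn i x : x != 0 -> partial i sqn x = 2 * x i 0.
Proof.
move=> x0.
have sc j : smooth punctured (fun x : V => x j 0) by exact: smooth_coord.
have sc2 j := smooth_mul punctured_open (sc j) (sc j).
have -> : sqn = (fun x => \sum_j ((fun x : V => x j 0) \* (fun x : V => x j 0)) x) by [].
rewrite (partial_sum punctured_open i _ _ (x0 : punctured x) sc2) (bigD1 i) //= big1 => [|j ji].
  rewrite partialM; try by apply: smooth_derivable (sc i) x0.
  by rewrite partial_coord eqxx mulr1 addr0 mulr_natl mulr2n.
rewrite partialM; try by apply: smooth_derivable (sc j) x0.
by rewrite partial_coord (negbTE ji) mulr0 addr0.
Qed.

(* npow s x is |x|^s for the Euclidean norm. *)
Definition npow (s : R) x : R := sqn x `^ (s / 2).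

Lemma npow_gt0 s x : x != 0 -> 0 < npow s x.
Proof. by move=> x0; apply/powR_gt0/sqn_gt0. Qed.

Lemma npowD s t x : x != 0 -> npow (s + t) x = npow s x * npow t x.
Proof.
move=> x0; rewrite /npow mulrDl powRD //.
by rewrite (gt_eqF (sqn_gt0 x0)) implybT.
Qed.

Lemma npow0 x : npow 0 x = 1.
Proof. by rewrite /npow mul0r powRr0. Qed.

Lemma npow2 x : npow 2 x = sqn x.
Proof. by rewrite /npow divff // powRr1 // sqn_ge0. Qed.

Lemma npow_enorm x : npow 1 x = enorm x.
Proof. by rewrite /npow div1r powR12_sqrt // sqn_ge0. Qed.

Lemma npow_sphere s x : sphere x -> npow s x = 1.
Proof.
move=> x1; have -> : npow s x = (npow 1 x) `^ s.
  by rewrite /npow -powRrM; congr powR; rewrite div1r mulrC.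
by rewrite npow_enorm x1 powR1.
Qed.

Lemma npow_homog s : homog s (npow s).
Proof.
move=> t x t0 x0; rewrite /npow sqnZ powRM ?sqr_ge0 ?sqn_ge0 //.
congr (_ * _); rewrite -powR_mulrn ?ltW // -powRrM; congr powR.
by rewrite mulrCA divff // mulr1.
Qed.

Lemma npow_is_derive s i x : x != 0 ->
  is_derive x (e_ i) (npow s) (s * (x i 0 * npow (s - 2) x)).
Proof.
move=> x0; have q0 := sqn_gt0 x0.
have Dq := partial_is_derive i sqn_smooth x0; rewrite partial_sqn // in Dq.
have Dp := is_derive1_powR (s / 2) q0.
apply: is_derive_eq (is_derive_chain Dp Dq) _.
have -> : npow (s - 2) x = sqn x `^ (s / 2 - 1).
  by rewrite /npow mulrBl divff.
by rewrite -!mulrA (mulrCA _ 2) mulrA; field.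
Qed.

Lemma partial_npow s i x : x != 0 -> partial i (npow s) x = s * (x i 0 * npow (s - 2) x).
Proof. by move=> x0; exact: (@derive_val _ _ _ _ _ _ _ (npow_is_derive s i x0)). Qed.

Lemma npow_smooth s : smooth punctured (npow s).
Proof.
move=> k; elim: k s => [|k IH] s.
  move=> x x0; have q0 := sqn_gt0 x0.
  have Dp := is_derive1_powR (s / 2) q0.
  have cp : {for sqn x, continuous (fun a : R => a `^ (s / 2))}.
    by apply: differentiable_continuous; apply/derivable1_diffP; exact: (@ex_derive _ _ _ _ _ _ _ Dp).
  have cq := smooth_continuous sqn_smooth (x0 : punctured x).
  exact: (continuous_comp cq cp).
move=> i; split.
  by move=> x x0; exact: (@ex_derive _ _ _ _ _ _ _ (npow_is_derive s i x0)).
have C1 : Ck k punctured (fun x : V => x i 0) by exact: smooth_coord.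
have C2 : Ck k punctured (cst s : V -> R) by exact: smooth_cst.
apply: (Ck_ext punctured_open) (Ck_mul punctured_open C2 (Ck_mul punctured_open C1 (IH (s - 2)))).
by move=> x x0; rewrite partial_npow.
Qed.

Definition lap f x : R := \sum_i partial i (partial i f) x.

Lemma lap_ext f g x : (forall y, y != 0 -> f y = g y) -> x != 0 -> lap f x = lap g x.
Proof.
move=> fg x0; apply: eq_bigr => i _; apply: (partial_ext punctured_open) => // y y0.
exact: (partial_ext punctured_open).
Qed.

Lemma lapM f g x : smooth punctured f -> smooth punctured g -> x != 0 ->
  lap (f \* g) x = f x * lap g x + 2 * (\sum_i partial i f x * partial i g x) + g x * lap f x.
Proof.
move=> sf sg x0.
have D i h (y : V) : smooth punctured h -> y != 0 -> derivable h y (e_ i).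
  by move=> sh y0; exact: smooth_derivable sh y0.
rewrite /lap !mulr_sumr -!big_split /=; apply: eq_bigr => i _.
have sfi := smooth_partial i sf; have sgi := smooth_partial i sg.
rewrite (@partial_ext _ _ _ punctured_open i _
   ((f \* partial i g) \+ (g \* partial i f)) x) //; last first.
  by move=> y y0; rewrite partialM //; exact: D.
rewrite partialD; [|exact: (D i _ x (smooth_mul punctured_open sf sgi)) |
                    exact: (D i _ x (smooth_mul punctured_open sg sfi))].
rewrite !partialM; try by exact: D.
move: (f x) (g x) (partial i f x) (partial i g x) (partial i (partial i f) x)
  (partial i (partial i g) x) => a b c d a2 b2.
by ring.
Qed.

Lemma sum_sqn x : \sum_i x i 0 * x i 0 = sqn x.
Proof. by apply: eq_bigr => i _; rewrite expr2. Qed.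

Lemma lap_npow s x : x != 0 -> lap (npow s) x = s * (s + N%:R - 2) * npow (s - 2) x.
Proof.
move=> x0; rewrite /lap.
have sc i : smooth punctured (fun x : V => x i 0) by exact: smooth_coord.
have sn t := npow_smooth t.
have D i h (y : V) : smooth punctured h -> y != 0 -> derivable h y (e_ i).
  by move=> sh y0; exact: smooth_derivable sh y0.
have E i : partial i (partial i (npow s)) x =
   s * npow (s - 2) x + s * (s - 2) * npow (s - 2 - 2) x * (x i 0 * x i 0).
  rewrite (@partial_ext _ _ _ punctured_open i _
     (fun y => s * ((fun y : V => y i 0) \* npow (s - 2)) y) x) //; last first.
    by move=> y y0; rewrite partial_npow.
  rewrite (partial_scale i s (x0 : punctured x)
    (smooth_mul punctured_open (sc i) (sn _))).
  rewrite partialM; [|exact: D|exact: D].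
  rewrite partial_coord eqxx partial_npow //=.
  by move: (npow (s - 2) x) (npow (s - 2 - 2) x) (x i 0) => a b c; ring.
under eq_bigr do rewrite E.
rewrite big_split /= sumr_const card_ord -mulr_sumr sum_sqn -npow2 -!mulrA -npowD // subrK.
by rewrite -mulr_natr; ring.
Qed.

(** Euler's identity turns the cross term into a multiple of [f]. This formula is the passage
    between eigenfunctions of the sphere and harmonic functions, in both directions. *)
Lemma lap_npowM s d f x : smooth punctured f -> homog d f -> x != 0 ->
  lap (npow s \* f) x = npow s x * lap f x
     + s * (s + N%:R - 2 + 2 * d) * (npow (s - 2) x * f x).
Proof.
move=> sf hf x0; rewrite lapM //; last exact: npow_smooth.
have -> : \sum_i partial i (npow s) x * partial i f x = s * npow (s - 2) x * (d * f x).
  rewrite -(euler sf hf x0) mulr_sumr; apply: eq_bigr => i _.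
  by rewrite partial_npow //; ring.
by rewrite lap_npow //; ring.
Qed.

Lemma homogM a b f g : homog a f -> homog b g -> homog (a + b) (f \* g).
Proof.
move=> hf hg t x t0 x0 /=; rewrite hf // hg // powRD; last by rewrite (gt_eqF t0) implybT.
by ring.
Qed.

End Homogeneous.

(** * Maximum principle on the sphere *)

Section MaximumPrinciple.
Variables (R : realType) (N : nat).
Local Notation V := 'cV[R]_N.
Local Notation e_ i := (delta_mx i 0 : V).
Local Notation punctured := (@punctured R N).
Implicit Types (f g u : V -> R) (x y v : V).
Let pO := @punctured_open R N.

Lemma line_near x v (P : set V) : open P -> P x ->
  exists2 d : R, 0 < d & forall t : R, `|t| < d -> P (t *: v + x).
Proof.
move=> oP Px; have : nbhs x P by exact: open_nbhs_nbhs.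
move=> /nbhs_ballP[d /= d0 Hd]; exists (d / (`|v| + 1)).
  by rewrite divr_gt0 // ltr_wpDl.
move=> t td; apply: Hd; rewrite mx_norm_ball /ball_ /= opprD addrCA subrr addr0 normrN.
rewrite normrZ; apply: le_lt_trans (_ : `|t| * (`|v| + 1) < _).
  by rewrite ler_wpM2l // lerDl.
by rewrite -ltr_pdivlMr // ltr_wpDl.
Qed.

Lemma partial_at_max i f x : smooth punctured f -> x != 0 ->
  (forall y, y != 0 -> f y <= f x) -> partial i f x = 0.
Proof.
move=> sf x0 fmax; have [d d0 Hd] := line_near (e_ i) pO (x0 : punctured x).
pose g (t : R) := f (t *: e_ i + x).
have dg (t : R) : `|t| < d -> is_derive t (1:R) g (partial i f (t *: e_ i + x)).
  by move=> td; apply: is_derive_line; apply: partial_is_derive => //; exact: Hd.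
have Dm : is_derive (0:R) (1:R) g 0.
  apply: (@derive1_at_max R g (- d) d 0).
  - by rewrite ge0_cp ?ltW.
  - move=> t; rewrite in_itv /= -ltr_norml => td.
    exact: (@ex_derive _ _ _ _ _ _ _ (dg t td)).
  - by rewrite in_itv /= oppr_lt0 d0.
  - move=> t; rewrite in_itv /= -ltr_norml => td.
    by rewrite /g scale0r add0r; apply: fmax; exact: Hd.
have D0 : is_derive (0:R) (1:R) g (partial i f (0 *: e_ i + x)) by apply: dg; rewrite normr0.
rewrite -[x in LHS]add0r -(scale0r (e_ i)).
by rewrite -(@derive_val _ _ _ _ _ _ _ D0) (@derive_val _ _ _ _ _ _ _ Dm).
Qed.

(** If the second derivative were positive, the first one, which vanishes at [x], would be positive
    just after [x], and by the mean value theorem [f] would exceed its maximum. *)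
Lemma partial2_at_max i f x : smooth punctured f -> x != 0 ->
  (forall y, y != 0 -> f y <= f x) -> partial i (partial i f) x <= 0.
Proof.
move=> sf x0 fmax; rewrite leNgt; apply/negP => a0.
have g0 := partial_at_max i sf x0 fmax.
have [d d0 Hd] := line_near (e_ i) pO (x0 : punctured x).
have [D E] := partial_is_derive i (smooth_partial i sf) x0.
set a := partial i (partial i f) x in a0 E.
have : (h^-1 *: (partial i f (h *: e_ i + x) - partial i f x)) @[h --> (0:R)^'] --> a.
  by rewrite -E; exact: D.
move=> /cvgrPdist_lt /(_ _ a0) /nbhs_ballP[d' /= d'0 Hd'].
pose t := Num.min d d' / 2.
have m0 : 0 < Num.min d d' by rewrite lt_min d0.
have t0 : 0 < t by rewrite divr_gt0.
have tm : t < Num.min d d' by rewrite /t ltr_pdivrMr // ltr_pMr // ltr1n.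
have [td td'] : t < d /\ t < d' by apply/andP; rewrite -lt_min.
have small (s : R) : 0 <= s <= 1 -> 0 <= s * t <= t.
  by move=> /andP[s0 s1]; rewrite mulr_ge0 ?(ltW t0) //= ler_piMl // ltW.
have [|s /andP[s0 s1] Es] := @MVT_coord _ _ f x i t.
  move=> s /small/andP[st0 stt]; apply: smooth_derivable sf _; apply: Hd.
  by rewrite ger0_norm //; exact: le_lt_trans stt td.
have st0 : 0 < s * t by rewrite mulr_gt0.
have stt : s * t < t by rewrite gtr_pMl.
have {}Hd' := Hd' (s * t).
have : f (t *: e_ i + x) <= f x.
  by apply: fmax; apply: Hd; rewrite gtr0_norm.
apply/negP; rewrite -ltNge -subr_gt0 Es mulr_gt0 //.
have [] : ball (0:R) d' (s * t) /\ (s * t != 0).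
  split; last by rewrite gt_eqF.
  by rewrite /ball /= sub0r normrN gtr0_norm // (lt_trans stt).
move=> /Hd' /[apply]; rewrite g0 subr0 ltr_norml => /andP[_].
rewrite ltrBlDr -ltrBlDl subrr /GRing.scale /=.
by rewrite pmulr_rgt0 // invr_gt0.
Qed.

Lemma sphere_neq0 x : sphere x -> x != 0.
Proof.
move=> x1; apply/eqP => x0; have : sqn x `^ (1 / 2) = 1 by rewrite -[LHS]/(npow 1 x) npow_sphere.
rewrite x0 /sqn big1 ?powR0 // => [|i _]; last by rewrite mxE expr0n.
by move=> /esym/eqP; rewrite oner_eq0.
Qed.

Lemma sphere_sqn x : sphere x <-> sqn x = 1.
Proof.
split=> [x1|q1]; first by rewrite -npow2 npow_sphere.
by rewrite /sphere /= -npow_enorm /npow q1 powR1.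
Qed.

Lemma radialE x : radial x = npow (- 1) x *: x.
Proof.
rewrite /radial -npow_enorm; congr (_ *: _).
by rewrite /npow mulNr powRN.
Qed.

Lemma radial_sphere x : x != 0 -> sphere (radial x).
Proof.
move=> x0; apply/sphere_sqn; rewrite radialE sqnZ expr2 -npow2 -!npowD //.
by rewrite (_ : - 1 + - 1 + 2 = 0) ?npow0 //; ring.
Qed.

Lemma radialK x : x != 0 -> npow 1 x *: radial x = x.
Proof. by move=> x0; rewrite radialE scalerA -npowD // subrr npow0 scale1r. Qed.

Lemma radial_id x : sphere x -> radial x = x.
Proof. by move=> x1; rewrite radialE npow_sphere // scale1r. Qed.

Lemma homog_radial d f x : homog d f -> x != 0 -> f x = npow d x * f (radial x).
Proof.
move=> hf x0; have r0 := sphere_neq0 (radial_sphere x0).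
have : f (npow 1 x *: radial x) = npow 1 x `^ d * f (radial x) by apply: hf => //; exact: npow_gt0.
by rewrite radialK // /npow -powRrM div1r [2^-1 * d]mulrC.
Qed.

Lemma trmx_continuous : continuous (fun r : 'rV[R]_N => r^T : V).
Proof.
move=> r; suff : (fun r' : 'rV[R]_N => r'^T : V) @ r --> (r^T : V) by [].
apply/(@cvgrPdist_lt _ V _ (nbhs r)) => e e0.
apply/nbhs_ballP; exists e => // r'; rewrite mx_norm_ball /ball_ /= => h.
apply: (le_lt_trans _ h); rewrite -linearB /=.
rewrite [leLHS]/Num.Def.normr/= mx_normrE; apply: bigmax_le => // -[i j] _.
rewrite mxE /= [leRHS]/Num.Def.normr/= mx_normrE.
exact: (le_bigmax _ (fun ij : 'I_1 * 'I_N => `|(r - r') ij.1 ij.2|) (j, i)).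
Qed.

Lemma sphere_nonempty : (0 < N)%N -> exists x, sphere x.
Proof.
move=> N0; exists (e_ (Ordinal N0)); apply/sphere_sqn.
rewrite /sqn (bigD1 (Ordinal N0)) //= big1 => [|i /negbTE ne]; rewrite mxE !eqxx.
  by rewrite expr1n addr0.
by rewrite ne expr0n.
Qed.

Lemma sphere_max f : (0 < N)%N -> smooth punctured f ->
  exists2 x, sphere x & forall y, sphere y -> f y <= f x.
Proof.
(* The extreme value theorem used here is about row vectors, hence the transposed sphere. *)
move=> N0 sf; pose A := [set r : 'rV[R]_N | sphere (r^T)].
have cf : {within A, continuous (f \o trmx)}.
  apply: continuous_in_subspaceT => r; rewrite inE => /sphere_neq0 r0.
  apply: continuous_comp; first exact: trmx_continuous.
  exact: smooth_continuous sf r0.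
have A0 : A !=set0.
  by have [x x1] := sphere_nonempty N0; exists x^T; rewrite /A /= trmxK.
have cA : compact A.
  apply: bounded_closed_compact.
    exists 1; split; first exact: num_real.
    move=> M M1 r /= /sphere_sqn r1; apply/ltW/le_lt_trans/M1.
    rewrite [leLHS]/Num.Def.normr/= mx_normrE; apply: bigmax_le => // -[i j] _.
    rewrite -(ler_pXn2r (ltn0Sn 1)) ?nnegrE // expr1n -r1 real_normK ?num_real //.
    rewrite /sqn (bigD1 j) //= mxE ord1 lerDl.
    by apply: sumr_ge0 => k _; exact: sqr_ge0.
  have -> : A = (fun r : 'rV[R]_N => sqn r^T) @^-1` [set 1].
    by apply/seteqP; split => r /= /sphere_sqn.
  have cq : continuous (fun r : 'rV[R]_N => sqn r^T).
    move=> r; apply: (@continuous_comp _ _ _ trmx (@sqn R N)); first exact: trmx_continuous.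
    apply: continuous_big => [|i _ v]; first exact: add_continuous.
    have ci := @coord_continuous R N 1 i 0 v.
    exact: (continuousM ci ci).
  apply: (closed_comp (fun r _ => cq r)); exact: closed_eq.
have [c cA1 cmax] := EVT_max_rV A0 cA cf.
exists c^T; first by rewrite inE in cA1.
by move=> y y1; have := cmax y^T; rewrite /= trmxK; apply; rewrite inE /A /= trmxK.
Qed.

(** In degree 0 a maximum over the sphere is a maximum over the punctured space; the Laplacian there
    is nonpositive, and it equals [c] times the maximum. *)
Lemma eigen_pos_le0 f (c : R) : smooth punctured f -> homog 0 f -> 0 < c ->
  (forall x, sphere x -> lap f x = c * f x) -> forall x, x != 0 -> f x <= 0.
Proof.
move=> sf hf c0 lf x x0.
have [N0|N0] := posnP N.
  have : x = 0 by apply/colP => -[m mN]; exfalso; move: mN; rewrite N0.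
  by move/eqP: x0.
have f0 y : y != 0 -> f y = f (radial y).
  by move=> y0; rewrite (homog_radial hf) // npow0 mul1r.
have [y y1 ymax] := sphere_max N0 sf.
have fmax z : z != 0 -> f z <= f y.
  by move=> z0; rewrite f0 //; apply: ymax; exact: radial_sphere.
apply: le_trans (fmax x x0) _; rewrite -(pmulr_rle0 _ c0) -lf //.
by apply: sumr_le0 => i _; apply: partial2_at_max => //; exact: sphere_neq0.
Qed.

Lemma smooth_opp f : smooth punctured f -> smooth punctured (fun x => - f x).
Proof.
move=> sf; have := smooth_scale pO (-1) sf; apply: (smooth_ext pO) => x _.
by rewrite mulN1r.
Qed.

Lemma lap_scale c f x : smooth punctured f -> x != 0 -> lap (fun y => c * f y) x = c * lap f x.
Proof.
move=> sf x0; rewrite /lap mulr_sumr; apply: eq_bigr => i _.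
rewrite -(@partial_scale _ _ punctured i c (partial i f) x x0 (smooth_partial i sf)).
apply: (partial_ext pO) => // y y0.
exact: (@partial_scale _ _ punctured i c f y y0).
Qed.

Lemma eigen_pos_eq0 f (c : R) : smooth punctured f -> homog 0 f -> 0 < c ->
  (forall x, sphere x -> lap f x = c * f x) -> forall x, x != 0 -> f x = 0.
Proof.
move=> sf hf c0 lf x x0; apply/eqP; rewrite eq_le (eigen_pos_le0 sf hf c0 lf) //=.
rewrite -oppr_le0 -mulN1r.
apply: (@eigen_pos_le0 (fun x => -1 * f x) c) => //.
- exact: smooth_scale.
- by move=> t y t0 y0; rewrite hf //; ring.
- by move=> y y1; rewrite lap_scale //; [rewrite lf //; ring | exact: sphere_neq0].
Qed.

(** There is no condition at the origin, so negative degrees are allowed. *)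
Definition harmonic f := [/\ smooth punctured f & forall x, x != 0 -> lap f x = 0].

(* Harmonic functions of negative degree above 2 - N are the eigenfunctions of the sphere with a
   negative eigenvalue, which the maximum principle excludes. *)
Lemma harmonic_neg_eq0 d f : 2 - N%:R < d < 0 -> harmonic f -> homog d f ->
  forall x, x != 0 -> f x = 0.
Proof.
move=> /andP[dN d0] [sf lf] hf x x0.
have sn := @npow_smooth R N (- d).
have : (npow (- d) \* f) x = 0.
  (* The constant is the one [lap_npowM] gives for the exponent [- d]; it is positive because
     [2 - N < d < 0]. *)
  apply: (@eigen_pos_eq0 _ (- d * (d + N%:R - 2))) => //.
  - exact: smooth_mul.
  - by rewrite -(addNr d); apply: homogM => //; exact: npow_homog.
  - by rewrite mulr_gt0 ?oppr_gt0 //; lra.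
  - move=> y y1; have y0 := sphere_neq0 y1.
    by rewrite (lap_npowM _ sf hf y0) lf //= !npow_sphere //; ring.
move=> /eqP; rewrite mulf_eq0 gt_eqF ?npow_gt0 //= => /eqP; exact.
Qed.

Lemma harmonic_partial i f : harmonic f -> harmonic (partial i f).
Proof.
move=> [sf lf]; split; first exact: smooth_partial.
move=> x x0; have sfj j := smooth_partial j (smooth_partial j sf).
have E j : partial j (partial j (partial i f)) x = partial i (partial j (partial j f)) x.
  have E1 := schwarz pO j i (smooth_partial j sf) (x0 : punctured x).
  have E2 y (y0 : punctured y) := schwarz pO j i sf y0.
  have E3 := @partial_ext R N punctured pO j _ _ x x0 E2.
  exact: (etrans E3 E1).
rewrite /lap (eq_bigr _ (fun j _ => E j)).
have <- := @partial_sum _ _ _ pO i _ (index_enum 'I_N) xpredT _ x x0 sfj.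
have -> : partial i (fun y => \sum_j partial j (partial j f) y) x = partial i (cst 0) x.
  exact: (@partial_ext _ _ _ pO i (lap f) (cst 0) x x0 lf).
exact: partial_cst.
Qed.

End MaximumPrinciple.

(** * The plane: angular derivative and periodicity *)

Section Circle.
Variable R : realType.
Local Notation V := 'cV[R]_2.
Local Notation punctured := (@punctured R 2).
Implicit Types (f u : V -> R) (x y : V).
Let pO := @punctured_open R 2.
Local Notation i0 := (ord0 : 'I_2).
Local Notation i1 := (ord_max : 'I_2).

Lemma sum2E (F : 'I_2 -> R) : \sum_i F i = F i0 + F i1.
Proof. by rewrite big_ord_recl big_ord1; congr (_ + F _); exact: val_inj. Qed.

Definition rot90 x : V := \col_i (if i == i0 then - x i1 0 else x i0 0).

Definition circle x (t : R) : V := cos t *: x + sin t *: rot90 x.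

(** The infinitesimal rotation, [d/dtheta] in polar coordinates. *)
Definition angular u x : R := x i0 0 * partial i1 u x - x i1 0 * partial i0 u x.

Lemma circleE x (t : R) i j : circle x t i j = cos t * x i j + sin t * rot90 x i j.
Proof. by rewrite /circle mxE; congr (_ + _); rewrite mxE. Qed.

Lemma trig_derive (a b t : R) :
  is_derive t (1:R) (fun s => cos s * a + sin s * b) (- sin t * a + cos t * b).
Proof.
have -> : (fun s => cos s * a + sin s * b) = (a *: @cos R) + (b *: @sin R).
  by apply/funext => s; rewrite [cos s * a]mulrC [sin s * b]mulrC.
have D1 := @is_deriveZ _ _ _ (@cos R) a t 1 _ (is_derive_cos t).
have D2 := @is_deriveZ _ _ _ (@sin R) b t 1 _ (is_derive_sin t).
by apply: is_derive_eq (is_deriveD D1 D2) _; rewrite /GRing.scale /= mulrC [cos t * _]mulrC.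
Qed.

Lemma circle_diff x (t : R) : differentiable (circle x) t /\
  'd (circle x) t 1 = - sin t *: x + cos t *: rot90 x.
Proof.
have Dij i j : is_derive t (1:R) (fun s => circle x s i j) (- sin t * x i j + cos t * rot90 x i j).
  have -> : (fun s => circle x s i j) = (fun s => cos s * x i j + sin s * rot90 x i j).
    by apply/funext => s; exact: circleE.
  exact: trig_derive.
have D : derivable (circle x) t 1.
  by apply/derivable_mxP => i j; exact: (@ex_derive _ _ _ _ _ _ _ (Dij i j)).
have d : differentiable (circle x) t by apply/derivable1_diffP.
split; first exact: d.
rewrite -(deriveE _ d) (derive_mx D); apply/matrixP => i j.
rewrite mxE (@derive_val _ _ _ _ _ _ _ (Dij i j)) [RHS]mxE.
by congr (_ + _); rewrite [RHS]mxE.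
Qed.

Lemma circle0E x t : circle x t i0 0 = cos t * x i0 0 - sin t * x i1 0.
Proof. by rewrite circleE [rot90 x _ _]mxE eqxx mulrN. Qed.

Lemma circle1E x t : circle x t i1 0 = cos t * x i1 0 + sin t * x i0 0.
Proof. by rewrite circleE [rot90 x _ _]mxE. Qed.

Lemma circle_neq0 x t : x != 0 -> circle x t != 0.
Proof.
move=> /sqn_gt0 x0; apply/eqP => c0; have : sqn (circle x t) = sqn x.
  rewrite /sqn !sum2E circle0E circle1E.
  have := cos2Dsin2 t; move: (cos t) (sin t) (x i0 0) (x i1 0) => c s a b cs.
  have -> : (c * a - s * b) ^+ 2 + (c * b + s * a) ^+ 2 = (c ^+ 2 + s ^+ 2) * (a ^+ 2 + b ^+ 2).
    by ring.
  by rewrite cs mul1r.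
rewrite c0 => E; move: x0; rewrite -E /sqn big1 ?ltxx // => i _; by rewrite mxE expr0n.
Qed.

Lemma angular_derive u x t : smooth punctured u -> x != 0 ->
  is_derive t (1:R) (fun t => u (circle x t)) (angular u (circle x t)).
Proof.
move=> su x0; have c0 := circle_neq0 t x0.
have [du Eu] := smooth_diff pO su (c0 : punctured (circle x t)).
have [dc Ec] := circle_diff x t.
have D : differentiable (u \o circle x) t by exact: differentiable_comp.
split; first exact: diff_derivable.
rewrite (deriveE _ D) diff_comp //= Ec Eu /lincomb sum2E /angular.
rewrite circle0E circle1E !mxE /=.
move: (partial i0 u _) (partial i1 u _) => p q.
by ring.
Qed.

Lemma angular_smooth u : smooth punctured u -> smooth punctured (angular u).
Proof.
move=> su; have sc i : smooth punctured (fun x : V => x i 0) by exact: smooth_coord.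
have s1 := smooth_mul pO (sc i0) (smooth_partial i1 su).
have s2 := smooth_mul pO (sc i1) (smooth_partial i0 su).
apply: (smooth_ext pO _ (smooth_add pO s1 (smooth_opp s2))) => x _ //.
Qed.

(** At the point [(y, z)], [w] is the value of [u], [p] and [q] are its first derivatives, [a] and
    [b] the pure second ones, [c] and [d] the mixed ones. The hypotheses are the symmetry of second
    derivatives, harmonicity, and Euler's identity for [p], [q] and [w]. *)
Fact angular2_alg (s a b c d p q w y z : R) : c = d -> a + b = 0 ->
  y * a + z * c = (s - 1) * p -> y * d + z * b = (s - 1) * q -> y * p + z * q = s * w ->
  y * (y * b + q * 0 + -1 * (z * c + p * 1)) - z * (y * d + q * 1 + -1 * (z * a + p * 0)) =
    - (s ^+ 2 * w).
Proof.
move=> -> ab e0 e1 e.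
have b_a : b = - a by lra.
have e0' : z * d = (s - 1) * p - y * a by rewrite -e0; ring.
have e1' : y * d = (s - 1) * q - z * b by rewrite -e1; ring.
have -> : s ^+ 2 * w = s * (y * p + z * q) by rewrite e; ring.
have -> : y * (y * b + q * 0 + -1 * (z * d + p * 1)) - z * (y * d + q * 1 + -1 * (z * a + p * 0)) =
   - (y * (y * a) + y * (z * d) + z * (y * d) + z * (z * b)) - (y * p + z * q) by rewrite b_a; ring.
by rewrite e0' e1'; ring.
Qed.

(* In the plane, |x|^2 Delta = E^2 + A^2 for the Euler operator E and the angular derivative A. *)
Lemma angular2 s u x : harmonic u -> homog s u -> x != 0 ->
  angular (angular u) x = - (s ^+ 2 * u x).
Proof.
move=> [su lu] hu x0.
have sc i : smooth punctured (fun x : V => x i 0) by exact: smooth_coord.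
have sp i := smooth_partial i su.
have D i f : smooth punctured f -> derivable f x (delta_mx i 0).
  by move=> sf; exact: (smooth_derivable sf (x0 : punctured x)).
have E i : partial i (angular u) x =
   x i0 0 * partial i (partial i1 u) x + partial i1 u x * (i0 == i)%:R
    + -1 * (x i1 0 * partial i (partial i0 u) x + partial i0 u x * (i1 == i)%:R).
  have s1 := smooth_mul pO (sc i0) (sp i1); have s2 := smooth_mul pO (sc i1) (sp i0).
  have -> : angular u = ((fun x : V => x i0 0) \* partial i1 u) \+
       (fun x => -1 * ((fun x : V => x i1 0) \* partial i0 u) x).
    by apply/funext => y; rewrite /= mulN1r.
  rewrite partialD; [|exact: D s1|exact: (D i _ (smooth_scale pO _ s2))].
  rewrite (partial_scale i _ (x0 : punctured x) s2).
  rewrite partialM; [|exact: D|exact: D].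
  rewrite partialM; [|exact: D|exact: D].
  by rewrite !partial_coord.
have e0 := euler su hu x0; rewrite sum2E in e0.
have e1 i := euler (sp i) (partial_homog i su hu) x0.
have e10 := e1 i0; have e11 := e1 i1; rewrite sum2E in e10; rewrite sum2E in e11.
have l0 := lu x x0; rewrite /lap sum2E in l0.
have S := schwarz pO i1 i0 su x0.
have -> : angular (angular u) x =
   x i0 0 * partial i1 (angular u) x - x i1 0 * partial i0 (angular u) x by [].
rewrite (E i0) (E i1) /=.
exact: angular2_alg S l0 e10 e11 e0.
Qed.

(** From [1 - cos (2 a) = 2 sin^2 a] with [a = s pi] strictly between 0 and [pi]. *)
Lemma cos_2pi_neq1 (s : R) : 0 < s < 1 -> cos (s * (pi *+ 2)) != 1.
Proof.
move=> /andP[s0 s1]; have p0 := pi_gt0 R.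
have : 0 < sin (s * pi).
  by apply: sin_gt0_pi; rewrite mulr_gt0 //= gtr_pMl.
have -> : s * (pi *+ 2) = (s * pi) *+ 2 by rewrite mulrnAr.
rewrite cos_mulr2n cos2sin2 => h; apply/eqP => E.
have : sin (s * pi) ^+ 2 = 0 by lra.
by move/eqP; rewrite sqrf_eq0 gt_eqF.
Qed.

Lemma circle_period x : circle x (pi *+ 2) = x.
Proof. by rewrite /circle cos2pi sin2pi scale1r scale0r addr0. Qed.

Lemma circle_start x : circle x 0 = x.
Proof. by rewrite /circle cos0 sin0 scale1r scale0r addr0. Qed.

Fact rotation_system_eq0 (a b p q : R) : 0 < a ^+ 2 + b ^+ 2 ->
  a * p + b * q = 0 -> a * q - b * p = 0 -> p = 0 /\ q = 0.
Proof.
move=> /lt0r_neq0 n0 e1 e2; split; apply: (mulfI n0); rewrite mulr0.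
- have -> : (a ^+ 2 + b ^+ 2) * p = a * (a * p + b * q) - b * (a * q - b * p) by ring.
  by rewrite e1 e2; ring.
- have -> : (a ^+ 2 + b ^+ 2) * q = b * (a * p + b * q) + a * (a * q - b * p) by ring.
  by rewrite e1 e2; ring.
Qed.

(** Along a circle [u] solves [U'' = - s^2 U] and has period [2 pi]. For [s = 0] this makes the
    angular derivative vanish, and Euler's identity kills the radial one; for [0 < s < 1] only the
    zero solution has this period. *)
Lemma harmonic_plane_base s u : 0 <= s < 1 -> harmonic u -> homog s u ->
  forall i x, x != 0 -> partial i u x = 0.
Proof.
move=> /andP[s0 s1] Hu hu i x x0; have [su _] := Hu.
have sv := angular_smooth su.
have Du y t : y != 0 -> is_derive t (1:R) (fun t => u (circle y t)) (angular u (circle y t)).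
  by exact: angular_derive.
have Dv y t : y != 0 -> is_derive t (1:R) (fun t => angular u (circle y t))
    (- (s ^+ 2 * u (circle y t))).
  move=> y0; apply: is_derive_eq; first exact: (angular_derive t sv y0).
  by apply: angular2 => //; exact: circle_neq0.
move: s0; rewrite le_eqVlt => /predU1P[s0|s0].
  subst s.
  have v0 y : y != 0 -> angular u y = 0.
    move=> y0; have vc t : angular u (circle y t) = angular u y.
      rewrite -[in RHS](circle_start y); apply: (@is_derive_0_is_cst _ (fun t => angular u (circle y t))) => r.
      by have := Dv y r y0; rewrite expr0n mul0r oppr0.
    (* A constant angular derivative would make [u] grow linearly around the circle; a full turn
       shows that the slope is zero. *)
    pose g t := u (circle y t) - t * angular u y.
    have Dg t : is_derive t (1:R) g 0.
      have D1 : is_derive t (1:R) (fun t => t * angular u y) (angular u y).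
        have D2 := @is_deriveZ _ _ _ id (angular u y) t 1 _ (is_derive_id _ _).
        have -> : (fun t => t * angular u y) = (angular u y) \*: (id : R -> R).
          by apply/funext => r; rewrite mulrC.
        by apply: is_derive_eq D2 _; rewrite [LHS]mulr1.
      by apply: is_derive_eq (is_deriveB (Du y t y0) D1) _; rewrite vc subrr.
    have : g (pi *+ 2) = g 0 by apply: is_derive_0_is_cst.
    rewrite /g circle_period circle_start mul0r subr0 => /eqP.
    rewrite subr_eq addrC -subr_eq subrr eq_sym mulf_eq0 mulrn_eq0 /= gt_eqF ?pi_gt0 //=.
    by move/eqP.
  have e0 := euler su hu x0; rewrite sum2E mul0r in e0.
  have a0 := v0 x x0; rewrite /angular in a0.
  have q0 := sqn_gt0 x0; rewrite /sqn sum2E in q0.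
  have [P0 P1] := rotation_system_eq0 q0 e0 a0.
  have [->//|ii] := eqVneq i i0.
  have -> // : i = i1.
  by apply: val_inj; case: i ii => -[|[|//]].
have u0 y : y != 0 -> u y = 0.
  move=> y0.
  have Dl (t : R) : is_derive t (1:R) (fun t : R => s * t) s.
    by apply: is_derive_eq; rewrite [LHS]mulr1.
  have Dc t : is_derive t (1:R) (fun t => cos (s * t)) (- sin (s * t) * s).
    exact: (@is_derive1_comp _ (@cos R) (fun t => s * t)).
  have Ds t : is_derive t (1:R) (fun t => sin (s * t)) (cos (s * t) * s).
    exact: (@is_derive1_comp _ (@sin R) (fun t => s * t)).
  pose U t := u (circle y t); pose W t := angular u (circle y t).
  pose C t := cos (s * t); pose S t := sin (s * t).
  have DU t : is_derive t (1:R) U (W t) by exact: Du.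
  have DW t : is_derive t (1:R) W (- (s ^+ 2 * U t)) by exact: Dv.
  have DC t : is_derive t (1:R) C (- S t * s) by exact: Dc.
  have DS t : is_derive t (1:R) S (C t * s) by exact: Ds.
  (* [A] and [B] are first integrals of the oscillator: the components of [(s U, W)] rotated by the
     angle [s t]. *)
  pose A t := s * (U t * C t) - W t * S t.
  pose B t := s * (U t * S t) + W t * C t.
  have DM (f g : R -> R) (t a b : R) : is_derive t (1:R) f a -> is_derive t (1:R) g b ->
     is_derive t (1:R) (fun t => f t * g t) (f t * b + g t * a).
    by move=> Df Dg; exact: (@is_deriveM _ _ f g t 1 a b Df Dg).
  have DA t : is_derive t (1:R) A 0.
    have D1 := DM _ _ t _ _ (DU t) (DC t).
    have D2 := DM _ _ t _ _ (DW t) (DS t).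
    have D3 := is_deriveB (@is_deriveZ R R R (fun t => U t * C t) s t 1 _ D1) D2.
    apply: is_derive_eq D3 _; rewrite /GRing.scale /=.
    by move: (U t) (C t) (W t) (S t) => a b c d; ring.
  have DB t : is_derive t (1:R) B 0.
    have D1 := DM _ _ t _ _ (DU t) (DS t).
    have D2 := DM _ _ t _ _ (DW t) (DC t).
    have D3 := is_deriveD (@is_deriveZ R R R (fun t => U t * S t) s t 1 _ D1) D2.
    apply: is_derive_eq D3 _; rewrite /GRing.scale /=.
    by move: (U t) (C t) (W t) (S t) => a b c d; ring.
  have EA : A (pi *+ 2) = A 0 by apply: is_derive_0_is_cst.
  have EB : B (pi *+ 2) = B 0 by apply: is_derive_0_is_cst.
  move: EA EB; rewrite /A /B /U /W /C /S circle_period circle_start mulr0 cos0 sin0.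
  have := cos_2pi_neq1 (introT andP (conj s0 s1)).
  have := cos2Dsin2 (s * (pi *+ 2)).
  move: (cos _) (sin _) (u y) (angular u y) => c d a b cd c1 EA EB.
  (* After a full turn [(s a, b)] is fixed by the rotation of angle [2 pi s]; [2 - 2 c] is the
     determinant of this rotation minus the identity. *)
  have : (2 - 2 * c) * (s * a) = 0.
    have E1 : s * a * (c - 1) = b * d by lra.
    have E2 : b * (c - 1) = - (s * a * d) by lra.
    have -> : (2 - 2 * c) * (s * a) = (c ^+ 2 + d ^+ 2 + 1 - 2 * c) * (s * a) by rewrite cd; ring.
    have -> : (c ^+ 2 + d ^+ 2 + 1 - 2 * c) * (s * a) = (c - 1) * (s * a * (c - 1)) + d ^+ 2 * (s * a).
      by ring.
    rewrite E1; have -> : (c - 1) * (b * d) = (b * (c - 1)) * d by ring.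
    by rewrite E2; ring.
  move/eqP; rewrite !mulf_eq0 (gt_eqF s0) /= => /orP[/eqP c2|/eqP//].
  by move/eqP: c1; case; lra.
rewrite (@partial_ext _ _ _ pO i u (cst 0) x x0 u0).
exact: partial_cst.
Qed.

End Circle.

(** * Descent on the degree by differentiation *)

Section Ladder.
Variables (R : realType) (N : nat).
Local Notation V := 'cV[R]_N.
Local Notation e_ i := (delta_mx i 0 : V).
Local Notation punctured := (@punctured R N).
Implicit Types (f g u : V -> R) (x y v : V).
Let pO := @punctured_open R N.

Lemma grad0_segment f x y : smooth punctured f ->
  (forall i z, z != 0 -> partial i f z = 0) ->
  (forall t : R, 0 <= t <= 1 -> t *: (y - x) + x != 0) -> f x = f y.
Proof.
move=> sf f0 seg; pose v := y - x.
have D (t : R) : 0 <= t <= 1 -> derivable f (t *: v + x) v /\ 'D_v f (t *: v + x) = 0.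
  move=> t01; have [d E] := smooth_diff pO sf (seg t t01 : punctured _).
  split; first exact: diff_derivable.
  rewrite deriveE // E /lincomb big1 // => i _.
  by rewrite f0 ?mulr0 //; exact: seg.
have [|t /andP[t0 t1] E] := @MVT_line _ _ f x v.
  by move=> t t01; have [] := D t t01.
have t01 : 0 <= t <= 1 by rewrite !ltW.
move: E; have [_ ->] := D t t01; rewrite /v subrK => /eqP.
by rewrite subr_eq0 => /eqP.
Qed.

(** Segments must avoid the origin. If [x j 0] is nonzero and [i != j], the segment from [x] to the
    basis vector [i] does: its coordinate [j] vanishes only at the far end. *)
Lemma grad0_const f : (1 < N)%N -> smooth punctured f ->
  (forall i z, z != 0 -> partial i f z = 0) ->
  forall x y, x != 0 -> y != 0 -> f x = f y.
Proof.
move=> N1 sf f0.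
have e0 i : e_ i != 0.
  by apply/eqP => /matrixP /(_ i 0); rewrite !mxE !eqxx => /eqP; rewrite oner_eq0.
have step x i j : j != i -> x j 0 != 0 -> f x = f (e_ i).
  move=> ji xj; apply: grad0_segment => // t /andP[t0 t1].
  have [->|tn1] := eqVneq t 1; first by rewrite scale1r subrK.
  apply/eqP => /matrixP /(_ j 0); rewrite !mxE eqxx andbT (negbTE ji) sub0r => /eqP.
  have -> : t * - x j 0 + x j 0 = (1 - t) * x j 0 by ring.
  by rewrite mulf_eq0 (negbTE xj) orbF subr_eq0 eq_sym (negbTE tn1).
have ee i j : f (e_ i) = f (e_ j).
  have [->//|ij] := eqVneq i j.
  by apply: (step _ _ i ij); rewrite mxE !eqxx oner_eq0.
have toe x : x != 0 -> exists i, f x = f (e_ i).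
  move=> x0; have [j xj] : exists j, x j 0 != 0.
    apply: contrapT => h; move/eqP: x0; apply; apply/colP => j; rewrite mxE.
    by apply/eqP/negPn/negP => xj; apply: h; exists j.
  pose i : 'I_N := if j == Ordinal N1 then Ordinal (ltnW N1) else Ordinal N1.
  exists i; apply: step xj; rewrite /i.
  by have [->|] := eqVneq j (Ordinal N1).
move=> x y /toe[i ->] /toe[j ->]; exact: ee.
Qed.

(** For [N >= 4] the gradient has degree [s - 1], in [[-1,0)] and so above [2 - N], and
    [harmonic_neg_eq0] applies to it. *)
Lemma harmonic_base s u : (N = 2%N \/ (3 < N)%N) -> 0 <= s < 1 -> harmonic u -> homog s u ->
  forall i x, x != 0 -> partial i u x = 0.
Proof.
move=> [N2|N3] s01 Hu hu i x x0.
  clear pO; subst N; exact: harmonic_plane_base s01 Hu hu i x x0.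
have [su _] := Hu.
apply: (@harmonic_neg_eq0 _ _ (s - 1)) x0; last exact: partial_homog.
- have : (4 <= N%:R :> R) by rewrite (ler_nat R 4).
  by move: s01 => /andP[? ?] ?; apply/andP; split; lra.
- exact: harmonic_partial.
Qed.

Lemma homog_zero_grad s u : smooth punctured u -> homog s u -> s != 0 ->
  (forall i x, x != 0 -> partial i u x = 0) -> forall x, x != 0 -> u x = 0.
Proof.
move=> su hu s0 gu x x0; apply: (mulfI s0); rewrite -(euler su hu x0) mulr0.
by apply: big1 => i _; rewrite gu ?mulr0.
Qed.

Lemma harmonic_frac_eq0 k (sigma : R) u : (N = 2%N \/ (3 < N)%N) -> 0 < sigma < 1 ->
  harmonic u -> homog (k%:R + sigma) u -> forall x, x != 0 -> u x = 0.
Proof.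
move=> hN /andP[s0 s1]; elim: k u => [|k IH] u Hu hu.
  have [su _] := Hu; rewrite add0r in hu.
  apply: (homog_zero_grad su hu); first by rewrite gt_eqF.
  by apply: harmonic_base Hu hu => //; rewrite (ltW s0).
have [su _] := Hu.
apply: (homog_zero_grad su hu); first by rewrite gt_eqF // ltr_pwDr.
move=> i; apply: (IH _ (harmonic_partial i Hu)).
have -> : k%:R + sigma = k.+1%:R + sigma - 1 by rewrite -natr1; ring.
exact: partial_homog.
Qed.

Lemma harmonic_deg0_const u : (N = 2%N \/ (3 < N)%N) -> harmonic u -> homog 0 u ->
  exists c, forall x, x != 0 -> u x = c.
Proof.
move=> hN Hu hu; have [su _] := Hu.
have N1 : (1 < N)%N by case: hN => [->//|]; apply: ltn_trans.
have gu := harmonic_base hN _ Hu hu.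
have e0 : e_ (Ordinal N1) != 0.
  by apply/eqP => /matrixP /(_ (Ordinal N1) 0); rewrite !mxE !eqxx => /eqP; rewrite oner_eq0.
exists (u (e_ (Ordinal N1))) => x x0; apply: grad0_const => //.
by apply: gu; rewrite lexx ltr01.
Qed.

End Ladder.

(** * Harmonic polynomials *)

Section Exponents.
Variable T : finType.
Local Notation expo := {ffun T -> nat}.
Implicit Types (al be : expo) (p : T) (k : nat).

Definition inc p al : expo := [ffun i => (al i + (i == p))%N].
Definition dec p al : expo := [ffun i => (al i - (i == p))%N].
Definition deg al : nat := (\sum_p al p)%N.

Lemma incK p al : dec p (inc p al) = al.
Proof. by apply/ffunP => i; rewrite !ffunE addnK. Qed.

Lemma decK p al : (0 < al p)%N -> inc p (dec p al) = al.
Proof.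
move=> ap; apply/ffunP => i; rewrite !ffunE subnK //.
by case: eqP => // ->.
Qed.

Lemma inc_inj p : injective (inc p).
Proof. exact: can_inj (incK p). Qed.

Lemma inc_eq p al : inc p al p = (al p).+1.
Proof. by rewrite ffunE eqxx addn1. Qed.

Lemma inc_neq p i al : i != p -> inc p al i = al i.
Proof. by rewrite ffunE => /negbTE ->; rewrite addn0. Qed.

Lemma incC p i al : inc p (inc i al) = inc i (inc p al).
Proof. by apply/ffunP => j; rewrite !ffunE addnAC. Qed.

Lemma dec_incC p i al : p != i -> dec p (inc i al) = inc i (dec p al).
Proof.
move=> pi; apply/ffunP => j; rewrite !ffunE.
by case: (j =P p) => [->|_]; rewrite ?(negbTE pi) ?addn0 ?subn0.
Qed.

Lemma deg_inc p al : deg (inc p al) = (deg al).+1.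
Proof.
rewrite /deg (eq_bigr (fun i => al i + (i == p))%N); last by move=> i _; rewrite ffunE.
have E : (\sum_i (i == p) = 1)%N.
  by rewrite (bigD1 p) //= eqxx big1 // => i /negbTE ->.
by rewrite big_split /= E addn1.
Qed.

Lemma deg0 : deg [ffun=> 0%N] = 0%N.
Proof. by rewrite /deg big1 // => i _; rewrite ffunE. Qed.

Lemma deg_eq0 al : deg al = 0%N -> al = [ffun=> 0%N].
Proof.
move=> /eqP; rewrite sum_nat_eq0 => /forallP h; apply/ffunP => i.
by rewrite ffunE; apply/eqP/(implyP (h i)).
Qed.

Lemma deg_ge al p : (al p <= deg al)%N.
Proof. by rewrite /deg (bigD1 p) //= leq_addr. Qed.

Lemma deg_succ al k : deg al = k.+1 -> exists p be, al = inc p be /\ deg be = k.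
Proof.
move=> ad; have [p ap] : exists p, (0 < al p)%N.
  apply: contrapT => h; have : deg al = 0%N.
    apply: big1 => p _; apply/eqP; rewrite -leqn0 leqNgt; apply/negP => ap.
    by apply: h; exists p.
  by rewrite ad.
exists p, (dec p al); split; first by rewrite decK.
by apply: succn_inj; rewrite -(deg_inc p) decK.
Qed.

Lemma expo_ind (P : expo -> Prop) : P [ffun=> 0%N] ->
  (forall p al, P al -> P (inc p al)) -> forall al, P al.
Proof.
move=> P0 PS al; move E : (deg al) => k.
elim: k al E => [|k IH] al E; first by rewrite (deg_eq0 E).
by have [p [be [-> /IH/PS]]] := deg_succ E.
Qed.

Definition to_expo k (f : {ffun T -> 'I_k.+1}) : expo := [ffun p => f p : nat].

Lemma to_expo_inj k : injective (@to_expo k).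
Proof.
move=> f g /ffunP fg; apply/ffunP => p; apply: val_inj.
by have := fg p; rewrite !ffunE.
Qed.

(** The entries of an exponent of degree [k] are at most [k], so a finite type of functions contains
    them all. *)
Definition expos k : seq expo := [seq al <- map (@to_expo k) (enum {ffun T -> 'I_k.+1}) | deg al == k].

Lemma expos_uniq k : uniq (expos k).
Proof.
apply: filter_uniq; rewrite map_inj_uniq; first exact: enum_uniq.
exact: to_expo_inj.
Qed.

Lemma mem_expos k al : (al \in expos k) = (deg al == k).
Proof.
rewrite mem_filter; case: eqP => //= ad.
apply/mapP; exists [ffun p => inord (al p)]; first by rewrite mem_enum.
by apply/ffunP => p; rewrite !ffunE inordK // ltnS -ad deg_ge.
Qed.

Lemma expos_perm_inc k p : perm_eq [seq inc p be | be <- expos k] [seq al : expo <- expos k.+1 | (0 < al p)%N].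
Proof.
apply: uniq_perm.
- by rewrite map_inj_uniq ?expos_uniq //; exact: inc_inj.
- exact/filter_uniq/expos_uniq.
move=> al; rewrite mem_filter mem_expos; apply/mapP/andP.
- by move=> [be]; rewrite mem_expos => /eqP bk ->; rewrite inc_eq deg_inc bk.
- move=> [ap /eqP ad]; exists (dec p al); last by rewrite decK.
  by rewrite mem_expos -eqSS -(deg_inc p) decK // ad.
Qed.

Variable R : pzRingType.

(** The shift of index caused by differentiation: the terms with [al p = 0] drop out, the others are
    of the form [inc p be]. *)
Lemma sum_expos_inc k p (F : expo -> R) :
  \sum_(al <- expos k.+1) (al p)%:R * F al = \sum_(be <- expos k) (be p).+1%:R * F (inc p be).
Proof.
rewrite (bigID (fun al : expo => (0 < al p)%N)) /= [X in _ + X]big1 ?addr0; last first.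
  by move=> al; rewrite -leqNgt leqn0 => /eqP ->; rewrite mul0r.
rewrite -big_filter -(perm_big _ (expos_perm_inc k p)) big_map.
by apply: eq_bigr => be _; rewrite inc_eq.
Qed.

(** The Leibniz rule on exponents. When [al p = 0] the truncated [dec] returns a wrong exponent, but
    its coefficient is 0. *)
Lemma inc_dec_expand p i al (G : expo -> R) :
  (inc i al p)%:R * G (dec p (inc i al)) = (p == i)%:R * G al + (al p)%:R * G (inc i (dec p al)).
Proof.
have [->|pi] := eqVneq p i.
  rewrite inc_eq incK -add1n natrD mulrDl; congr (_ + _).
  have [a0|ap] := posnP (al i); first by rewrite a0 !mul0r.
  by rewrite decK.
by rewrite inc_neq // dec_incC // mul0r add0r.
Qed.

End Exponents.

(** * Conjugation of exponents and real monomials *)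

Section Swap.
Variable n : nat.
Local Notation expo := {ffun 'I_n * bool -> nat}.
Implicit Types (al be : expo) (j : 'I_n) (c : bool).

Definition swap al : expo := [ffun p => al (p.1, ~~ p.2)].

Lemma swapK : involutive swap.
Proof. by move=> al; apply/ffunP => -[j c]; rewrite !ffunE /= negbK. Qed.

Lemma swap_inc j c al : swap (inc (j, c) al) = inc (j, ~~ c) (swap al).
Proof.
apply/ffunP => -[i d]; rewrite !ffunE /= !xpair_eqE.
by congr (_ + (_ && _))%N; case: c; case: d.
Qed.

Lemma deg_swap al : deg (swap al) = deg al.
Proof.
rewrite /deg; under eq_bigr do rewrite ffunE.
rewrite [RHS](reindex_inj (h := fun p : 'I_n * bool => (p.1, ~~ p.2))) //=.
by move=> [i c] [j d] /= [-> /negb_inj ->].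
Qed.

Lemma expos_perm_swap k : perm_eq (map swap (expos _ k)) (expos _ k).
Proof.
apply: uniq_perm.
- by rewrite map_inj_uniq ?expos_uniq //; exact: inv_inj swapK.
- exact: expos_uniq.
move=> al; rewrite mem_expos; apply/mapP/idP => [[be]|ak].
  by rewrite mem_expos => /eqP bk ->; rewrite deg_swap bk.
by exists (swap al); rewrite ?swapK // mem_expos deg_swap.
Qed.

Lemma sum_expos_swap (R : nmodType) k (F : expo -> R) :
  \sum_(al <- expos _ k) F (swap al) = \sum_(al <- expos _ k) F al.
Proof. by rewrite -[RHS](perm_big _ (expos_perm_swap k)) big_map. Qed.

End Swap.

Section Hartley.
Variables (R : realType) (N n : nat) (ix iy : 'I_n -> 'I_N).
Hypothesis ix_inj : injective ix.
Hypothesis iy_inj : injective iy.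
Hypothesis ixy_neq : forall i j, ix i != iy j.
Hypothesis sum_ixy : forall F : 'I_N -> R, \sum_k F k = \sum_j (F (ix j) + F (iy j)).
Local Notation V := 'cV[R]_N.
Local Notation expo := {ffun 'I_n * bool -> nat}.
Local Notation punctured := (@punctured R N).
Let pO := @punctured_open R N.
Implicit Types (x : V) (al be : expo) (j : 'I_n) (c : bool).

Local Notation X j x := (x (ix j) 0).
Local Notation Y j x := (x (iy j) 0).

(* An exponent al stands for the monomial with z_j to the power al (j, false) and the conjugate of z_j
   to the power al (j, true), where z_j = X_j + i Y_j. *)
Definition zcoord (p : 'I_n * bool) x : R[i] := (X p.1 x +i* ((-1) ^+ p.2 * Y p.1 x))%C.

Definition zmono al x : R[i] := \prod_p zcoord p x ^+ al p.

(* Conjugating w = zmono al x exchanges al and swap al.  Hence the functions Re w + Im w, one for each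
   exponent, form a real basis of the real polynomials, although the z_j are complex. *)
Definition hart al x : R := complex.Re (zmono al x) + complex.Im (zmono al x).

Lemma zmono_inc p al x : zmono (inc p al) x = zcoord p x * zmono al x.
Proof.
rewrite /zmono; under eq_bigr do rewrite ffunE exprD.
rewrite big_split mulrC /=; congr (_ * _).
by rewrite (bigD1 p) //= eqxx expr1 big1 ?mulr1 // => q /negbTE ->.
Qed.

Lemma zmono_swap al x : zmono (swap al) x = (zmono al x)^*%C.
Proof.
rewrite /zmono rmorph_prod.
rewrite (reindex_inj (h := fun p : 'I_n * bool => (p.1, ~~ p.2))) /=; last first.
  by move=> [i c] [j d] /= [-> /negb_inj ->].
apply: eq_bigr => -[j c] _; rewrite ffunE /= negbK rmorphXn; congr (_ ^+ _).
by rewrite /zcoord /=; case: c; rewrite /= ?expr0 ?expr1 ?mul1r ?mulN1r ?opprK.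
Qed.

Lemma hart0 x : hart [ffun=> 0%N] x = 1.
Proof. by rewrite /hart /zmono big1 /= ?addr0 // => p _; rewrite ffunE expr0. Qed.

(** For [w = a + i b], the sum of the real and imaginary parts of [(X + i Y) w] is
    [X (a + b) + Y (a - b)], and [a - b] is the value at the conjugate monomial. This recursion
    replaces complex multiplication from here on. *)
Lemma hart_inc j c al x :
  hart (inc (j, c) al) x = X j x * hart al x + (-1) ^+ c * Y j x * hart (swap al) x.
Proof.
rewrite /hart zmono_inc zmono_swap; case: (zmono al x) => a b /=.
by move: ((-1) ^+ c * Y j x) => y; ring.
Qed.

(** The induction adapted to [hart_inc], whose right-hand side involves both [al] and [swap al]. *)
Lemma expo_swap_ind (P : expo -> Prop) : P [ffun=> 0%N] ->
  (forall j c al, P al -> P (swap al) -> P (inc (j, c) al)) -> forall al, P al.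
Proof.
move=> P0 PS al; suff [] : P al /\ P (swap al) by [].
elim/expo_ind: al => [|[j c] al [IH1 IH2]].
  by split => //; have -> : swap [ffun=> 0%N] = [ffun=> 0%N] :> expo by apply/ffunP => p; rewrite !ffunE.
by rewrite swap_inc; split; apply: PS; rewrite ?swapK.
Qed.

Lemma hart_smooth al : smooth punctured (hart al).
Proof.
elim/expo_swap_ind: al => [|j c al s1 s2].
  have -> : hart [ffun=> 0%N] = cst 1 by apply/funext => x; rewrite hart0.
  exact: smooth_cst.
have sc i : smooth punctured (fun x : V => x i 0) by exact: smooth_coord.
have S := smooth_add pO (smooth_mul pO (sc (ix j)) s1)
  (smooth_mul pO (smooth_scale pO ((-1) ^+ c) (sc (iy j))) s2).
by apply: (smooth_ext pO) S => x _; rewrite hart_inc.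
Qed.

Lemma hart_scale al (t : R) x : hart al (t *: x) = t ^+ deg al * hart al x.
Proof.
elim/expo_swap_ind: al => [|j c al s1 s2]; first by rewrite deg0 expr0 !hart0 mul1r.
by rewrite !hart_inc s1 s2 deg_inc deg_swap !mxE exprS; ring.
Qed.

Lemma mulX_hart j al x : X j x * hart al x = 2^-1 * (hart (inc (j, false) al) x + hart (inc (j, true) al) x).
Proof. by rewrite !hart_inc expr0 expr1; field. Qed.

Lemma mulY_hart j al x : Y j x * hart al x =
  2^-1 * (hart (inc (j, false) (swap al)) x - hart (inc (j, true) (swap al)) x).
Proof. by rewrite !hart_inc expr0 expr1 swapK; field. Qed.

Lemma partial_hart_inc k j c al x : x != 0 ->
  partial k (hart (inc (j, c) al)) x =
    (ix j == k)%:R * hart al x + X j x * partial k (hart al) x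
    + (-1) ^+ c * ((iy j == k)%:R * hart (swap al) x + Y j x * partial k (hart (swap al)) x).
Proof.
move=> x0.
have sc i : smooth punctured (fun x : V => x i 0) by exact: smooth_coord.
have D i f : smooth punctured f -> derivable f x (delta_mx i 0).
  by move=> sf; exact: (smooth_derivable sf (x0 : punctured x)).
have s1 := smooth_mul pO (sc (ix j)) (hart_smooth al).
have s2 := smooth_mul pO (sc (iy j)) (hart_smooth (swap al)).
have -> : hart (inc (j, c) al) = ((fun x : V => X j x) \* hart al) \+
   (fun x => (-1) ^+ c * ((fun x : V => Y j x) \* hart (swap al)) x).
  by apply/funext => y; rewrite hart_inc -mulrA.
rewrite partialD; [|exact: D s1|exact: D (smooth_scale pO _ s2)].
rewrite (partial_scale k _ (x0 : punctured x) s2).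
rewrite partialM; [|exact: D (sc _)|exact: D (hart_smooth _)].
rewrite partialM; [|exact: D (sc _)|exact: D (hart_smooth _)].
rewrite !partial_coord.
move: (partial k _ x) (partial k _ x) => a b.
by congr (_ + _ * _); rewrite addrC; congr (_ + _); rewrite mulrC.
Qed.

(** This is [d/dX = d/dz + d/dzbar], the two terms being indexed by [c]. *)
Lemma partialX_hart i al x : x != 0 ->
  partial (ix i) (hart al) x = \sum_(c : bool) (al (i, c))%:R * hart (dec (i, c) al) x.
Proof.
move=> x0; elim/expo_swap_ind: al => [|j c al IH1 IH2].
  have -> : hart [ffun=> 0%N] = cst 1 by apply/funext => y; rewrite hart0.
  by rewrite partial_cst big1 // => c _; rewrite ffunE mul0r.
rewrite partial_hart_inc // IH1 IH2 (inj_eq ix_inj) eq_sym [iy j == _]eq_sym (negbTE (ixy_neq _ _)).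
under [RHS]eq_bigr => d _ do rewrite (inc_dec_expand _ _ _ (hart^~ x)) hart_inc.
rewrite !big_bool /= !ffunE /=.
have swd d : swap (dec (i, d) al) = dec (i, ~~ d) (swap al).
  by apply/ffunP => -[k e]; rewrite !ffunE /= !xpair_eqE; congr (_ - (_ && _))%N; case: d; case: e.
rewrite !swd !xpair_eqE /=.
case: c; rewrite /= ?andbT ?andbF ?expr0 ?expr1; case: (i == j) => /=; by ring.
Qed.

(** This is [d/dY = i (d/dz - d/dzbar)]; multiplication by [i] turns [Re + Im] into [Re - Im], hence
    the [swap]. *)
Lemma partialY_hart i al x : x != 0 ->
  partial (iy i) (hart al) x = \sum_(c : bool) (-1) ^+ c * ((al (i, c))%:R * hart (swap (dec (i, c) al)) x).
Proof.
move=> x0; elim/expo_swap_ind: al => [|j c al IH1 IH2].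
  have -> : hart [ffun=> 0%N] = cst 1 by apply/funext => y; rewrite hart0.
  by rewrite partial_cst big1 // => c _; rewrite ffunE mul0r mulr0.
rewrite partial_hart_inc // IH1 IH2 (inj_eq iy_inj) (negbTE (ixy_neq _ _)).
have swd d be : swap (dec (i, d) be) = dec (i, ~~ d) (swap be).
  by apply/ffunP => -[k e]; rewrite !ffunE /= !xpair_eqE; congr (_ - (_ && _))%N; case: d; case: e.
under [RHS]eq_bigr => d _ do rewrite (inc_dec_expand _ _ _ (fun be => hart (swap be) x)) swap_inc hart_inc swapK.
rewrite !big_bool /= !ffunE /= !swd swapK !xpair_eqE /=.
case: c; rewrite /= ?andbT ?andbF ?expr0 ?expr1 [i == j]eq_sym; case: (j == i) => /=; by ring.
Qed.

End Hartley.

(** * Homogeneous polynomials through their coefficients *)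

Section HartleyCombination.
Variables (R : realType) (N n : nat) (ix iy : 'I_n -> 'I_N).
Hypothesis ix_inj : injective ix.
Hypothesis iy_inj : injective iy.
Hypothesis ixy_neq : forall i j, ix i != iy j.
Hypothesis sum_ixy : forall F : 'I_N -> R, \sum_k F k = \sum_j (F (ix j) + F (iy j)).
Local Notation V := 'cV[R]_N.
Local Notation T := ('I_n * bool)%type.
Local Notation expo := {ffun T -> nat}.
Local Notation punctured := (@punctured R N).
Local Notation hart := (hart ix iy).
Let pO := @punctured_open R N.
Implicit Types (x : V) (al be : expo) (j : 'I_n) (c : bool) (r : expo -> R) (k : nat).

Local Notation X j x := (x (ix j) 0).
Local Notation Y j x := (x (iy j) 0).

Definition lc k r x : R := \sum_(al <- expos T k) r al * hart al x.

Definition dX i r be : R := \sum_(c : bool) (be (i, c)).+1%:R * r (inc (i, c) be).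

Definition dY i r be : R :=
  \sum_(c : bool) (-1) ^+ c * ((swap be (i, c)).+1%:R * r (inc (i, c) (swap be))).

Lemma lc_ext k r r' x : (forall al, deg al = k -> r al = r' al) -> lc k r x = lc k r' x.
Proof.
move=> rr; apply: eq_big_seq => al; rewrite mem_expos => /eqP ak.
by rewrite rr.
Qed.

Lemma lcD k r r' x : lc k (fun al => r al + r' al) x = lc k r x + lc k r' x.
Proof. by rewrite /lc -big_split; apply: eq_bigr => al _; rewrite mulrDl. Qed.

Lemma lcZ k (a : R) r x : lc k (fun al => a * r al) x = a * lc k r x.
Proof. by rewrite /lc mulr_sumr; apply: eq_bigr => al _; rewrite mulrA. Qed.

Lemma lc_sum k (I : Type) (s : seq I) (r : I -> expo -> R) x :
  lc k (fun al => \sum_(i <- s) r i al) x = \sum_(i <- s) lc k (r i) x.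
Proof.
rewrite /lc exchange_big /=; apply: eq_bigr => al _.
by rewrite mulr_suml.
Qed.

Lemma lc_smooth k r : smooth punctured (lc k r).
Proof.
by apply: (smooth_sum pO) => al; apply: (smooth_scale pO); exact: hart_smooth.
Qed.

Lemma lc_scale k r (t : R) x : lc k r (t *: x) = t ^+ k * lc k r x.
Proof.
rewrite /lc mulr_sumr; apply: eq_big_seq => al; rewrite mem_expos => /eqP ak.
by rewrite hart_scale ak mulrCA.
Qed.

Lemma lc_homog k r : homog k%:R (lc k r).
Proof. by move=> t x t0 x0; rewrite lc_scale powR_mulrn // ltW. Qed.

Lemma partial_lc i k r x : x != 0 ->
  partial i (lc k r) x = \sum_(al <- expos T k) r al * partial i (hart al) x.
Proof.
move=> x0; have sh al := @hart_smooth R N n ix iy al.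
rewrite (partial_sum pO i _ _ (x0 : punctured x) (fun al => smooth_scale pO (r al) (sh al))).
apply: eq_bigr => al _.
exact: (@partial_scale _ _ punctured i (r al) _ x x0 (sh al)).
Qed.

Lemma partialX_lc i k r x : x != 0 -> partial (ix i) (lc k.+1 r) x = lc k (dX i r) x.
Proof.
move=> x0; rewrite partial_lc //.
under eq_bigr do rewrite partialX_hart // mulr_sumr.
rewrite exchange_big /= /lc /dX.
under [RHS]eq_bigr do rewrite mulr_suml.
rewrite [RHS]exchange_big /=; apply: eq_bigr => c _.
under eq_bigr do rewrite mulrCA.
rewrite (sum_expos_inc _ (i, c) (fun al => r al * hart (dec (i, c) al) x)).
by apply: eq_bigr => be _; rewrite incK mulrA.
Qed.

Lemma partialY_lc i k r x : x != 0 -> partial (iy i) (lc k.+1 r) x = lc k (dY i r) x.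
Proof.
move=> x0; rewrite partial_lc //.
under eq_bigr do rewrite partialY_hart // mulr_sumr.
rewrite exchange_big /= /lc /dY.
under [RHS]eq_bigr do rewrite mulr_suml.
rewrite [RHS]exchange_big /=; apply: eq_bigr => c _.
under eq_bigr do rewrite mulrCA (mulrCA (r _)).
rewrite -mulr_sumr (sum_expos_inc _ (i, c) (fun al => r al * hart (swap (dec (i, c) al)) x)).
under [RHS]eq_bigr do rewrite -mulrA.
rewrite -mulr_sumr; congr (_ * _); rewrite -[RHS]sum_expos_swap.
by apply: eq_bigr => be _; rewrite incK swapK mulrA.
Qed.

Lemma lc0_cst r : lc 0 r = cst (r [ffun=> 0%N]).
Proof.
apply/funext => x; have E : perm_eq (expos T 0) [:: [ffun=> 0%N]].
  apply: uniq_perm; rewrite ?expos_uniq // => al; rewrite mem_expos inE.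
  by apply/eqP/eqP => [/deg_eq0//|->]; exact: deg0.
by rewrite /lc (perm_big _ E) big_seq1 hart0 mulr1.
Qed.

(** The derivatives in [X_i] and [Y_i] have as coefficients the sum and the difference of multiples
    of the two coefficients at [inc (i, false) be] and [inc (i, true) be]; by induction on the
    degree both vanish. *)
Lemma lc_eq0 k r : (exists x : V, x != 0) -> (forall x, x != 0 -> lc k r x = 0) ->
  forall al, deg al = k -> r al = 0.
Proof.
move=> [x1 x10]; elim: k r => [|k IH] r lr al.
  by move=> /deg_eq0 ->; have := lr x1 x10; rewrite lc0_cst.
have p0 i x : x != 0 -> partial i (lc k.+1 r) x = 0.
  move=> x0; rewrite (@partial_ext _ _ _ pO i _ (cst 0) x x0 lr).
  exact: partial_cst.
move=> /deg_succ[[i c] [be [-> bk]]].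
have EX : dX i r be = 0.
  by apply: IH bk => x x0; rewrite -partialX_lc // p0.
have EY : dY i r (swap be) = 0.
  by apply: IH; rewrite ?deg_swap // => x x0; rewrite -partialY_lc // p0.
move: EX EY; rewrite /dX /dY swapK !big_bool /= expr0 expr1.
case: c; move: (r (inc (i, true) be)) (r (inc (i, false) be)) => a b.
  move=> e1 e2; have : (be (i, true)).+1%:R * a = 0 by lra.
  by move/eqP; rewrite mulf_eq0 pnatr_eq0 => /eqP.
move=> e1 e2; have : (be (i, false)).+1%:R * b = 0 by lra.
by move/eqP; rewrite mulf_eq0 pnatr_eq0 => /eqP.
Qed.

Lemma lc_inj k r r' : (exists x : V, x != 0) -> (forall x, x != 0 -> lc k r x = lc k r' x) ->
  forall al, deg al = k -> r al = r' al.
Proof.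
move=> hx E al ak; apply/eqP; rewrite -subr_eq0; apply/eqP.
have -> : r al - r' al = r al + -1 * r' al by rewrite mulN1r.
apply: (@lc_eq0 k (fun al => r al + -1 * r' al)) => // x x0.
by rewrite lcD lcZ E // mulN1r subrr.
Qed.

(* A quarter of the Laplacian, on coefficients. *)
Definition lap_coef r be : R := \sum_j (be (j, false)).+1%:R * (be (j, true)).+1%:R
  * r (inc (j, false) (inc (j, true) be)).

(** The Laplacian is [4 sum_j d/dz_j d/dzbar_j]: the unmixed terms of the second derivatives in
    [X_j] and [Y_j] cancel. *)
Lemma lap_lc k r x : x != 0 -> lap (lc k.+2 r) x = 4 * lc k (lap_coef r) x.
Proof.
move=> x0; rewrite /lap sum_ixy /lap_coef.
have EX i : partial (ix i) (partial (ix i) (lc k.+2 r)) x = lc k (dX i (dX i r)) x.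
  rewrite -partialX_lc //; apply: (partial_ext pO) => // y y0.
  exact: partialX_lc.
have EY i : partial (iy i) (partial (iy i) (lc k.+2 r)) x = lc k (dY i (dY i r)) x.
  rewrite -partialY_lc //; apply: (partial_ext pO) => // y y0.
  exact: partialY_lc.
under eq_bigr do rewrite EX EY -lcD.
rewrite -lc_sum -lcZ; apply: lc_ext => be _.
rewrite mulr_sumr; apply: eq_bigr => j _.
rewrite /dX /dY !big_bool /= !expr0 !expr1 !swap_inc !swapK /= !ffunE /= !xpair_eqE !eqxx /=.
rewrite !addn0 !addn1 [inc (j, true) (inc (j, false) be)]incC.
rewrite -!natr1. move: (r _) (r _) (r _) => a b c.
by ring.
Qed.

Lemma partial_lc0 i r x : partial i (lc 0 r) x = 0.
Proof. by rewrite lc0_cst partial_cst. Qed.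

Lemma lap_lc_small k r x : (k < 2)%N -> x != 0 -> lap (lc k r) x = 0.
Proof.
case: k => [|[|//]] _ x0; rewrite /lap.
  apply: big1 => i _; rewrite (@partial_ext _ _ _ pO i _ (cst 0) x) ?partial_cst //.
  by move=> y _; exact: partial_lc0.
rewrite sum_ixy; apply: big1 => i _.
rewrite (@partial_ext _ _ _ pO _ (partial (ix i) (lc 1 r)) (lc 0 (dX i r)) x) //; last first.
  by move=> y y0; exact: partialX_lc.
rewrite (@partial_ext _ _ _ pO _ (partial (iy i) (lc 1 r)) (lc 0 (dY i r)) x) //; last first.
  by move=> y y0; exact: partialY_lc.
by rewrite !partial_lc0 addr0.
Qed.

Lemma harmonic_lcP k r : (exists x : V, x != 0) ->
  harmonic (lc k r) <-> (forall be, (deg be).+2 = k -> lap_coef r be = 0).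
Proof.
move=> hx; case: k => [|[|k]].
- by split => // _; split; [exact: lc_smooth | move=> x; exact: lap_lc_small].
- by split => // _; split; [exact: lc_smooth | move=> x; exact: lap_lc_small].
split=> [[_ lr] be [bk]|lr].
  apply: (lc_eq0 hx _ bk) => x x0.
  by have := lr x x0; rewrite lap_lc // => /eqP; rewrite mulf_eq0 pnatr_eq0 => /eqP.
split; first exact: lc_smooth.
move=> x x0; rewrite lap_lc // (_ : lc k _ x = 0) ?mulr0 //.
apply: big1_seq => al /=; rewrite mem_expos => /eqP ak.
by rewrite lr ?mul0r ?ak.
Qed.

Definition is_lc k (f : V -> R) := exists r, forall x, x != 0 -> f x = lc k r x.

Lemma is_lc_hart al : is_lc (deg al) (hart al).
Proof.
exists (fun be => (be == al)%:R) => x _.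
rewrite /lc (bigD1_seq al) ?mem_expos ?expos_uniq //= eqxx mul1r big1 ?addr0 // => be /negbTE ->.
by rewrite mul0r.
Qed.

Lemma is_lc_ext k f g : (forall x, x != 0 -> f x = g x) -> is_lc k g -> is_lc k f.
Proof. by move=> fg [r gr]; exists r => x x0; rewrite fg // gr. Qed.

Lemma is_lcD k f g : is_lc k f -> is_lc k g -> is_lc k (fun x => f x + g x).
Proof.
by move=> [r fr] [r' gr]; exists (fun al => r al + r' al) => x x0; rewrite lcD fr // gr.
Qed.

Lemma is_lcZ k (a : R) f : is_lc k f -> is_lc k (fun x => a * f x).
Proof. by move=> [r fr]; exists (fun al => a * r al) => x x0; rewrite lcZ fr. Qed.

Lemma is_lc_sum k (I : eqType) (s : seq I) (F : I -> V -> R) :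
  (forall i, i \in s -> is_lc k (F i)) -> is_lc k (fun x => \sum_(i <- s) F i x).
Proof.
elim: s => [|i s IH] Fs.
  exists (fun=> 0) => x _; rewrite big_nil /lc big1 // => al _; exact: mul0r.
apply: (@is_lc_ext _ _ (fun x => F i x + \sum_(i <- s) F i x)).
  by move=> x _; rewrite big_cons.
apply: is_lcD; first by apply: Fs; rewrite mem_head.
by apply: IH => j js; apply: Fs; rewrite inE js orbT.
Qed.

Lemma is_lc_mulX j k f : is_lc k f -> is_lc k.+1 (fun x => X j x * f x).
Proof.
move=> [r fr]; apply: (@is_lc_ext _ _
  (fun x => \sum_(al <- expos T k) (r al * 2^-1) * (hart (inc (j, false) al) x + hart (inc (j, true) al) x))).
  move=> x x0; rewrite fr // /lc mulr_sumr; apply: eq_bigr => al _.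
  by rewrite mulrCA (mulX_hart ix iy) mulrA.
apply: is_lc_sum => al; rewrite mem_expos => /eqP ak.
apply: is_lcZ; have d c : deg (inc (j, c) al) = k.+1 by rewrite deg_inc ak.
by apply: is_lcD; [rewrite -(d false) | rewrite -(d true)]; exact: is_lc_hart.
Qed.

Lemma is_lc_mulY j k f : is_lc k f -> is_lc k.+1 (fun x => Y j x * f x).
Proof.
move=> [r fr]; apply: (@is_lc_ext _ _
  (fun x => \sum_(al <- expos T k) (r al * 2^-1) *
     (hart (inc (j, false) (swap al)) x + -1 * hart (inc (j, true) (swap al)) x))).
  move=> x x0; rewrite fr // /lc mulr_sumr; apply: eq_bigr => al _.
  by rewrite mulrCA (mulY_hart ix iy) mulrA mulN1r.
apply: is_lc_sum => al; rewrite mem_expos => /eqP ak.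
apply: is_lcZ; have d c : deg (inc (j, c) (swap al)) = k.+1 by rewrite deg_inc deg_swap ak.
by apply: is_lcD; [rewrite -(d false) | apply: is_lcZ; rewrite -(d true)]; exact: is_lc_hart.
Qed.

(* Euler's identity recovers a function from its first derivatives, which are harmonic of one
   degree less. *)
Lemma harmonic_poly k u : (N = 2%N \/ (3 < N)%N) -> harmonic u -> homog k%:R u -> is_lc k u.
Proof.
move=> hN; elim: k u => [|k IH] u Hu hu.
  have [c uc] := harmonic_deg0_const hN Hu hu.
  by exists (fun=> c) => x x0; rewrite lc0_cst uc.
have [su _] := Hu.
have pu i : is_lc k (partial i u).
  apply: (IH _ (harmonic_partial i Hu)).
  have -> : k%:R = k.+1%:R - 1 :> R by rewrite -natr1 addrK.
  exact: partial_homog.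
apply: (@is_lc_ext _ _ (fun x => k.+1%:R^-1 *
    (\sum_j (X j x * partial (ix j) u x + Y j x * partial (iy j) u x)))).
  move=> x x0; rewrite -(sum_ixy (fun i => x i 0 * partial i u x)) (euler su hu x0).
  by rewrite mulKf // pnatr_eq0.
apply: is_lcZ; apply: is_lc_sum => j _; apply: is_lcD; [exact: is_lc_mulX | exact: is_lc_mulY].
Qed.

End HartleyCombination.

(** * Harmonic polynomials with prescribed free coefficients *)

Section HarmonicExtension.
Variables (R : realType) (n : nat) (j0 : 'I_n).
Local Notation T := ('I_n * bool)%type.
Local Notation expo := {ffun T -> nat}.
Implicit Types (al be : expo) (j : 'I_n) (rho r : expo -> R) (k m : nat).

Definition inc2 j be : expo := inc (j, false) (inc (j, true) be).
Definition dec2 al : expo := dec (j0, false) (dec (j0, true) al).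
Definition pairs al : nat := minn (al (j0, false)) (al (j0, true)).
(** The weight [a - b] of the monomial, which determines how G acts on it. *)
Definition wt al : 'cV[int]_n := \col_j ((al (j, false))%:Z - (al (j, true))%:Z).

Local Notation coef j be := (((be (j, false)).+1%:R * (be (j, true)).+1%:R) : R).

(* Solves lap_coef r (dec2 al) = 0 for r al, in terms of coefficients with fewer pairs z_j0 zbar_j0. *)
Fixpoint hext_rec m rho al : R :=
  if m is m'.+1 then
    - ((\sum_(j | j != j0) coef j (dec2 al) * hext_rec m' rho (inc2 j (dec2 al)))
       / coef j0 (dec2 al))
  else rho al.

(** The number of pairs is exactly the fuel needed: the recursive terms have [j != j0], hence one
    pair fewer at [j0]. *)
Definition hext rho al : R := hext_rec (pairs al) rho al.

Lemma inc2E j be i c : inc2 j be (i, c) = (be (i, c) + (i == j))%N.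
Proof. by rewrite !ffunE !xpair_eqE; case: c; rewrite ?andbT ?andbF ?addn0. Qed.

Lemma pairs_inc2 be : pairs (inc2 j0 be) = (pairs be).+1.
Proof. by rewrite /pairs !inc2E eqxx !addn1 minnSS. Qed.

Lemma pairs_inc2_neq j be : j != j0 -> pairs (inc2 j be) = pairs be.
Proof. by rewrite /pairs !inc2E eq_sym => /negbTE ->; rewrite !addn0. Qed.

Lemma inc2K be : dec2 (inc2 j0 be) = be.
Proof. by rewrite /dec2 /inc2 incC !incK. Qed.

Lemma dec2K al : (0 < pairs al)%N -> inc2 j0 (dec2 al) = al.
Proof.
rewrite /pairs leq_min => /andP[a0 a1]; rewrite /dec2 /inc2 incC decK ?decK //.
by rewrite ffunE xpair_eqE andbF subn0.
Qed.

Lemma deg_inc2 j be : deg (inc2 j be) = (deg be).+2.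
Proof. by rewrite !deg_inc. Qed.

Lemma wt_inc2 j be : wt (inc2 j be) = wt be.
Proof. by apply/colP => i; rewrite !mxE !inc2E !PoszD; lra. Qed.

Lemma coef_neq0 j be : coef j be != 0.
Proof. by rewrite mulf_neq0 // pnatr_eq0. Qed.

Lemma hext_harmonic rho be : lap_coef (hext rho) be = 0.
Proof.
rewrite /lap_coef (bigD1 j0) //= -/(inc2 j0 be) /hext pairs_inc2 /= inc2K.
rewrite mulrN mulrC divfK ?coef_neq0 // addrC; apply/eqP; rewrite subr_eq0; apply/eqP.
by apply: eq_bigr => j jj0; rewrite -/(inc2 j be) pairs_inc2_neq.
Qed.

Lemma hext_free rho al : pairs al = 0%N -> hext rho al = rho al.
Proof. by rewrite /hext => ->. Qed.

(** The recursion trades a pair at [j0] for a pair at [j], which preserves the weight; hence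
    harmonic extension preserves invariance under G. *)
Lemma hext_supp rho (L : 'cV[int]_n -> Prop) :
  (forall al, ~ L (wt al) -> rho al = 0) -> forall al, ~ L (wt al) -> hext rho al = 0.
Proof.
move=> r0 al; rewrite /hext; move E : (pairs al) => m.
elim: m al E => [|m IH] al E nL; first exact: r0.
have ale : inc2 j0 (dec2 al) = al by rewrite dec2K ?E.
have wd : wt (dec2 al) = wt al by rewrite -{2}ale wt_inc2.
rewrite /= big1 ?mul0r ?oppr0 // => j jj0.
rewrite IH ?mulr0 ?wt_inc2 ?wd // pairs_inc2_neq //.
by apply: succn_inj; rewrite -pairs_inc2 ale.
Qed.

Lemma hext_unique k r r' :
  (forall be, (deg be).+2 = k -> lap_coef r be = 0) ->
  (forall be, (deg be).+2 = k -> lap_coef r' be = 0) ->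
  (forall al, deg al = k -> pairs al = 0%N -> r al = r' al) ->
  forall al, deg al = k -> r al = r' al.
Proof.
move=> lr lr' rr al; move E : (pairs al) => m.
elim: m al E => [|m IH] al E ak; first exact: rr.
have ale : inc2 j0 (dec2 al) = al by rewrite dec2K ?E.
have bk : (deg (dec2 al)).+2 = k by rewrite -ak -{2}ale deg_inc2.
apply: (mulfI (coef_neq0 j0 (dec2 al))).
have e r1 : lap_coef r1 (dec2 al) =
    coef j0 (dec2 al) * r1 al + \sum_(j | j != j0) coef j (dec2 al) * r1 (inc2 j (dec2 al)).
  by rewrite /lap_coef (bigD1 j0) //= -/(inc2 j0 (dec2 al)) ale.
have S : \sum_(j | j != j0) coef j (dec2 al) * r (inc2 j (dec2 al)) =
         \sum_(j | j != j0) coef j (dec2 al) * r' (inc2 j (dec2 al)).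
  apply: eq_bigr => j jj0; congr (_ * _); apply: IH; last by rewrite deg_inc2.
  by apply: succn_inj; rewrite pairs_inc2_neq // -pairs_inc2 ale.
have := lr _ bk; have := lr' _ bk; rewrite !e S => e1 e2.
by apply/(addIr (\sum_(j | j != j0) coef j (dec2 al) * r' (inc2 j (dec2 al)))); rewrite e1 e2.
Qed.

End HarmonicExtension.

(** * The spectrum of lens spaces *)

Section SphereSpectrum.
Variables (R : realType) (N : nat).
Local Notation V := 'cV[R]_N.
Local Notation punctured := (@punctured R N).
Local Notation radial := (@radial R N).
Implicit Types (f phi : V -> R) (x y : V).
Let pO := @punctured_open R N.

Lemma radialZ (t : R) x : 0 < t -> x != 0 -> radial (t *: x) = radial x.
Proof.
move=> t0 x0; rewrite !radialE npow_homog // powRN powRr1 ?ltW // scalerA mulrAC mulVf ?mul1r //.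
by rewrite gt_eqF.
Qed.

Lemma radial_homog0 phi : homog 0 (phi \o radial).
Proof. by move=> t x t0 x0; rewrite /= radialZ // powRr0 mul1r. Qed.

Lemma lap_homog d f : smooth punctured f -> homog d f -> homog (d - 1 - 1) (lap f).
Proof.
move=> sf hf t x t0 x0; rewrite /lap mulr_sumr; apply: eq_bigr => i _.
have sp := smooth_partial i sf.
exact: (partial_homog i sp (partial_homog i sf hf)).
Qed.

(** [div_sphere] extends the gradient with degree 0, that is, as [|y|] times the gradient of
    [phi \o radial], which has degree -1. The derivative of [|y|] contributes the radial derivative,
    which is zero. *)
Lemma laplace_sphereE phi x : smooth_on_sphere phi -> sphere x ->
  laplace_sphere phi x = lap (phi \o radial) x.
Proof.
move=> sphi x1; have x0 := sphere_neq0 x1.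
set F := phi \o radial; have sF : smooth punctured F by exact: sphi.
have hF : homog 0 F by exact: radial_homog0.
have sn : smooth punctured (npow 1) by exact: npow_smooth.
have D i f : smooth punctured f -> derivable f x (delta_mx i 0).
  by move=> sf; exact: (smooth_derivable sf (x0 : punctured x)).
have E i : partial i (fun y => grad_sphere phi (radial y) i 0) x =
    x i 0 * partial i F x + partial i (partial i F) x.
  have sp := smooth_partial i sF.
  rewrite (@partial_ext _ _ _ pO i _ (npow 1 \* partial i F) x x0); last first.
    move=> y y0; rewrite /grad_sphere mxE -/F radialE.
    rewrite (partial_homog i sF hF) ?npow_gt0 //= sub0r.
    by rewrite powRN powRr1 ?(ltW (npow_gt0 _ y0)) // /npow mulNr powRN invrK.
  rewrite partialM; [|exact: D|exact: D].
  by rewrite partial_npow // !npow_sphere // mul1r mul1r mulr1 addrC [partial i F x * _]mulrC.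
rewrite /laplace_sphere /div_sphere (eq_bigr _ (fun i _ => E i)) big_split /=.
by rewrite (euler sF hF x0) mul0r add0r.
Qed.

Definition sphere_eigen (lambda : R) phi := smooth_on_sphere phi /\
  (forall x, sphere x -> - (lambda * phi x) = laplace_sphere phi x).

Lemma sphere_eigen_lap lambda phi : sphere_eigen lambda phi ->
  forall x, x != 0 -> lap (phi \o radial) x = - lambda * (npow (- 2) x * (phi \o radial) x).
Proof.
move=> [sphi E] x x0; have hF := radial_homog0 phi.
rewrite (homog_radial (lap_homog sphi hF) x0) sub0r -opprD.
have r1 := radial_sphere x0.
by rewrite -laplace_sphereE // -E //=; rewrite -mulNr mulrCA.
Qed.

(** [lap_npowM] with [d = 0] produces [s (s + N - 2)], which cancels [lambda]. *)
Lemma sphere_eigen_harmonic lambda (s : R) phi : sphere_eigen lambda phi ->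
  lambda = s * (s + N%:R - 2) ->
  harmonic (npow s \* (phi \o radial)) /\ homog s (npow s \* (phi \o radial)).
Proof.
move=> Ephi ls; have [sphi _] := Ephi; have hF := radial_homog0 phi.
have sF : smooth punctured (phi \o radial) by exact: sphi.
split.
  have sn : smooth punctured (npow s) by exact: npow_smooth.
  split; first exact: (smooth_mul pO sn sF).
  move=> x x0; rewrite (lap_npowM s sF hF x0) (sphere_eigen_lap Ephi x0) mulr0 addr0 ls.
  by rewrite npowD //; ring.
by rewrite -[s]addr0; apply: homogM => //; rewrite addr0; exact: npow_homog.
Qed.

Lemma sphere_eigen_neg lambda phi : sphere_eigen lambda phi -> lambda < 0 ->
  forall x, sphere x -> phi x = 0.
Proof.
move=> Ephi l0 x x1; have [sphi _] := Ephi; rewrite -(radial_id x1).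
apply: (@eigen_pos_eq0 _ _ (phi \o radial) (- lambda)) => //.
- exact: radial_homog0.
- by rewrite oppr_gt0.
- by move=> y y1; rewrite (sphere_eigen_lap Ephi (sphere_neq0 y1)) npow_sphere // mul1r.
- exact: sphere_neq0.
Qed.

Definition sphere_eigenvalue (k : nat) : R := k%:R * (k%:R + N%:R - 2).

Lemma sphere_eigen_classify lambda phi : (N = 2%N \/ (3 < N)%N) -> sphere_eigen lambda phi ->
  (forall x, sphere x -> phi x = 0) \/
  exists k u, [/\ lambda = sphere_eigenvalue k, harmonic u, homog k%:R u &
    forall x, sphere x -> phi x = u x].
Proof.
move=> hN Ephi; have [l0|l0] := ltP lambda 0.
  by left; exact: sphere_eigen_neg Ephi l0.
have N2 : (2 <= N%:R :> R).
  by rewrite (ler_nat R 2); case: hN => [->//|]; apply: ltn_trans.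
(* [s] is the larger root of [s^2 + b s = lambda], nonnegative because [lambda >= 0]. *)
pose b : R := N%:R - 2; pose s : R := (Num.sqrt (b ^+ 2 + 4 * lambda) - b) / 2.
have b0 : 0 <= b by rewrite subr_ge0.
have D0 : 0 <= b ^+ 2 + 4 * lambda by rewrite addr_ge0 ?sqr_ge0 // mulr_ge0.
have sq := sqr_sqrtr D0.
have s0 : 0 <= s.
  rewrite divr_ge0 // subr_ge0 -{1}[b]ger0_norm // -sqrtr_sqr ler_wsqrtr //.
  by rewrite lerDl mulr_ge0.
have ls : lambda = s * (s + N%:R - 2).
  have -> : s * (s + N%:R - 2) = ((Num.sqrt (b ^+ 2 + 4 * lambda)) ^+ 2 - b ^+ 2) / 4.
    by rewrite /s -addrA -/b; field.
  by rewrite sq; field.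
have [Hu hu] := sphere_eigen_harmonic Ephi ls.
have us x : sphere x -> phi x = (npow s \* (phi \o radial)) x.
  by move=> x1; rewrite /= npow_sphere // mul1r radial_id.
pose k := Num.truncn s; have /andP[k1 k2] := truncn_itv s0.
have [sk|sk] := eqVneq s k%:R.
  right; exists k, (npow s \* (phi \o radial)); split => //; last by rewrite -sk.
  by rewrite /sphere_eigenvalue -sk.
left => x x1; rewrite us //.
apply: (@harmonic_frac_eq0 _ _ k (s - k%:R)) => //; last exact: sphere_neq0.
- by rewrite subr_gt0 lt_neqAle eq_sym sk k1 /= ltrBlDl natr1.
- by rewrite addrC subrK.
Qed.

Lemma harmonic_sphere_eigen k u : harmonic u -> homog k%:R u ->
  sphere_eigen (sphere_eigenvalue k) u.
Proof.
move=> [su lu] hu.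
have E x : x != 0 -> (npow (- k%:R) \* u) x = (u \o radial) x.
  move=> x0 /=; rewrite (homog_radial hu x0) mulrA -npowD // addNr npow0 mul1r //.
have ss : smooth_on_sphere u.
  have sn : smooth punctured (npow (- k%:R)) by exact: npow_smooth.
  exact: (smooth_ext pO E (smooth_mul pO sn su)).
split => // x x1; have x0 := sphere_neq0 x1.
rewrite (laplace_sphereE ss x1) -(lap_ext E x0) (lap_npowM _ su hu x0) lu //.
by rewrite !npow_sphere // /sphere_eigenvalue; ring.
Qed.

End SphereSpectrum.

(** * Coordinates and the action of the generator *)

Section LensCoordinates.
Variables (R : realType) (n q : nat) (p : 'I_n -> int).
Hypothesis n_gt0 : (0 < n)%N.
Hypothesis q_gt0 : (0 < q)%N.
Local Notation N := (\sum_(j < n) 2)%N.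
Local Notation V := 'cV[R]_N.
Local Notation T := ('I_n * bool)%type.
Local Notation expo := {ffun T -> nat}.
Local Notation G := (lens_group R q p).
Local Notation g := (lens_generator R q p).
Local Notation L := (lens_lattice q p).
Implicit Types (x : V) (j : 'I_n) (al be : expo) (r : expo -> R) (k : nat).

Definition ix j : 'I_N := @tagnat.Rank n (fun=> 2) j ord0.
Definition iy j : 'I_N := @tagnat.Rank n (fun=> 2) j ord_max.

Lemma lens_dim : N = 2%N \/ (3 < N)%N.
Proof.
rewrite sum_nat_const card_ord; case: n n_gt0 => [//|[|m]] _; first by left.
by right.
Qed.

Lemma rank_inj j j' (b b' : 'I_2) :
  @tagnat.Rank n (fun=> 2) j b = @tagnat.Rank n (fun=> 2) j' b' -> j = j' /\ b = b'.
Proof.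
move=> /tagnat.rank_inj E; split; first by have := congr1 tag E.
by have := congr1 (fun s : {i : 'I_n & 'I_2} => tagged s) E.
Qed.

Lemma ix_inj : injective ix.
Proof. by move=> j j' /rank_inj[]. Qed.

Lemma iy_inj : injective iy.
Proof. by move=> j j' /rank_inj[]. Qed.

Lemma ixy_neq j j' : ix j != iy j'.
Proof. by apply/eqP => /rank_inj[]. Qed.

Lemma sum_ixy (F : 'I_N -> R) : \sum_k F k = \sum_j (F (ix j) + F (iy j)).
Proof.
transitivity (\sum_j \sum_(b < 2) F (@tagnat.Rank n (fun=> 2) j b)).
  rewrite sig_big_dep /= (reindex _ (@tagnat.sig_bij_on n (fun=> 2))) /=.
  by apply: eq_bigr => k _; rewrite tagnat.sig2K.
by apply: eq_bigr => j _; rewrite sum2E.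
Qed.

Definition angle j : R := 2 * pi * (p j)%:~R / q%:R.

Lemma gen_coord x j (b : 'I_2) : (g *m x) (@tagnat.Rank n (fun=> 2) j b) 0 =
  \sum_(c < 2) rot2 (angle j) b c * x (@tagnat.Rank n (fun=> 2) j c) 0.
Proof.
have -> : (g *m x) (@tagnat.Rank n (fun=> 2) j b) 0 = (submxcol (p_ := fun=> 2) (g *m x) j) b 0.
  by rewrite [RHS]mxE.
rewrite -[x in LHS](submxcolK (p_ := fun=> 2)) /lens_generator mul_mxdiag_mxcol mxcolK mxE.
by apply: eq_bigr => c _; congr (_ * _); rewrite [LHS]mxE.
Qed.

Lemma rot2E (t : R) :
  [/\ rot2 t ord0 ord0 = cos t, rot2 t ord0 ord_max = - sin t,
      rot2 t ord_max ord0 = sin t & rot2 t ord_max ord_max = cos t].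
Proof.
have e0 : ord0 = lshift 1 (ord0 : 'I_1) :> 'I_2 by exact: val_inj.
have e1 : ord_max = rshift 1 (ord0 : 'I_1) :> 'I_2 by exact: val_inj.
rewrite e0 e1; split.
- by apply: etrans (@block_mxEul R 1 1 1 1 _ _ _ _ ord0 ord0) _; rewrite mxE.
- by apply: etrans (@block_mxEur R 1 1 1 1 _ _ _ _ ord0 ord0) _; rewrite mxE.
- by apply: etrans (@block_mxEdl R 1 1 1 1 _ _ _ _ ord0 ord0) _; rewrite mxE.
- by apply: etrans (@block_mxEdr R 1 1 1 1 _ _ _ _ ord0 ord0) _; rewrite mxE.
Qed.

Lemma genX x j : (g *m x) (ix j) 0 = cos (angle j) * x (ix j) 0 - sin (angle j) * x (iy j) 0.
Proof. by rewrite gen_coord sum2E; have [-> -> _ _] := rot2E (angle j); rewrite mulNr. Qed.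

Lemma genY x j : (g *m x) (iy j) 0 = sin (angle j) * x (ix j) 0 + cos (angle j) * x (iy j) 0.
Proof. by rewrite gen_coord sum2E; have [_ _ -> ->] := rot2E (angle j). Qed.

Lemma coord_ext x (y : V) : (forall j, x (ix j) 0 = y (ix j) 0) ->
  (forall j, x (iy j) 0 = y (iy j) 0) -> x = y.
Proof.
move=> ex ey; apply/eqP; rewrite -subr_eq0; apply/eqP/sqn_eq0.
rewrite /sqn sum_ixy big1 // => j _.
by rewrite 4!mxE ex ey !subrr !expr0n addr0.
Qed.

Lemma cos_2piz (z : int) : cos (2 * pi * z%:~R) = 1 :> R /\ sin (2 * pi * z%:~R) = 0 :> R.
Proof.
have H m : cos (2 * pi * m%:R) = 1 :> R /\ sin (2 * pi * m%:R) = 0 :> R.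
  elim: m => [|m [IH1 IH2]]; first by rewrite mulr0 cos0 sin0.
  have -> : 2 * pi * m.+1%:R = 2 * pi * m%:R + pi *+ 2 :> R by rewrite -natr1 -mulr_natl; ring.
  by rewrite cosD2pi sinD2pi.
case: z => m; first exact: H.
by rewrite NegzE mulrNz mulrN cosN sinN; have [-> ->] := H m.+1; rewrite oppr0.
Qed.

(** Only the remainder [m] of [t] modulo [q] matters; for [0 < m < q], [sin (pi m / q)] is positive
    and the cosine is [1 - 2 sin^2]. *)
Lemma cos_2pi_dvd (t : int) : cos (2 * pi * t%:~R / q%:R) = 1 :> R <-> (t = 0 %[mod q%:Z])%Z.
Proof.
have q0 : (q%:R : R) != 0 by rewrite pnatr_eq0 -lt0n.
rewrite mod0z; split; last first.
  move=> tq; have -> : 2 * pi * t%:~R / q%:R = 2 * pi * (t %/ q%:Z)%Z%:~R :> R.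
    rewrite {1}(divz_eq t q%:Z) tq addr0 intrM; by field.
  by have [] := cos_2piz (t %/ q%:Z)%Z.
rewrite {1}(divz_eq t q%:Z).
have : (0 <= (t %% q%:Z)%Z < q%:Z) by rewrite modz_ge0 ?ltz_pmod // eqz_nat -lt0n.
case: (t %% q%:Z)%Z => // m; rewrite /= ltz_nat => mq.
have -> : 2 * pi * ((t %/ q%:Z)%Z * q%:Z + m%:Z)%:~R / q%:R =
    2 * pi * m%:R / q%:R + 2 * pi * (t %/ q%:Z)%Z%:~R :> R.
  by rewrite intrD intrM; field.
have [c1 s1] := cos_2piz (t %/ q%:Z)%Z; rewrite cosD c1 s1 mulr1 mulr0 subr0.
case: m mq => // m mq E; exfalso.
have s0 : 0 < sin (pi * m.+1%:R / q%:R) :> R.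
  apply: sin_gt0_pi; rewrite divr_gt0 ?mulr_gt0 ?pi_gt0 ?ltr0n //=.
  by rewrite ltr_pdivrMr ?ltr0n // ltr_pM2l ?pi_gt0 // ltr_nat.
move: E; have -> : 2 * pi * m.+1%:R / q%:R = (pi * m.+1%:R / q%:R) *+ 2 :> R.
  by rewrite -mulr_natl; ring.
rewrite cos_mulr2n cos2sin2 => E.
have : sin (pi * m.+1%:R / q%:R) ^+ 2 = 0 :> R by lra.
by move/eqP; rewrite sqrf_eq0 gt_eqF.
Qed.

Lemma expg_coord k x j :
  (g ^+ k *m x) (ix j) 0 = cos (k%:R * angle j) * x (ix j) 0 - sin (k%:R * angle j) * x (iy j) 0 /\
  (g ^+ k *m x) (iy j) 0 = sin (k%:R * angle j) * x (ix j) 0 + cos (k%:R * angle j) * x (iy j) 0.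
Proof.
elim: k => [|k [IH1 IH2]].
  rewrite expr0 mul1mx mul0r cos0 sin0; split; ring.
have -> : g ^+ k.+1 *m x = g *m (g ^+ k *m x) by rewrite exprS mulmxA.
have -> : k.+1%:R * angle j = k%:R * angle j + angle j by rewrite -natr1; ring.
by rewrite genX genY IH1 IH2 cosD sinD; split; ring.
Qed.

Lemma expg_order x : g ^+ q *m x = x.
Proof.
have E j : cos (q%:R * angle j) = 1 /\ sin (q%:R * angle j) = 0.
  have -> : q%:R * angle j = 2 * pi * (p j)%:~R.
    by rewrite /angle mulrC divfK // pnatr_eq0 -lt0n.
  exact: cos_2piz.
apply: coord_ext => j; have [EX EY] := expg_coord q x j; have [c s] := E j.
  by rewrite EX c s; ring.
by rewrite EY c s; ring.
Qed.

Lemma orbit_self x : orbit_of G x x.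
Proof. by exists 1; [exists 0%N | rewrite mul1mx]. Qed.

Lemma orbit_gen x : orbit_of G (g *m x) = orbit_of G x.
Proof.
apply/seteqP; split => y [_ [k _ <-] <-].
  by exists (g ^+ k.+1); [exists k.+1 | rewrite exprSr mulmxA].
(* The group is given by natural powers only; on vectors [g ^+ q.-1] inverts [g]. *)
exists (g ^+ (k + q.-1)); first by exists (k + q.-1)%N.
have -> : g ^+ (k + q.-1) *m (g *m x) = g ^+ k *m (g ^+ q *m x).
  have mE (A B : 'M[R]_N) : A * B = A *m B by [].
  have gq : g ^+ q.-1.+1 = g ^+ q.-1 *m g by exact: exprSr.
  by rewrite prednK // in gq; rewrite exprD gq mE !mulmxA.
by rewrite expg_order.
Qed.

Lemma sqn_gen x : sqn (g *m x) = sqn x.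
Proof.
rewrite /sqn !sum_ixy; apply: eq_bigr => j _; rewrite genX genY.
have := cos2Dsin2 (angle j); move: (cos _) (sin _) (x (ix j) 0) (x (iy j) 0) => c s a b cs.
have -> : (c * a - s * b) ^+ 2 + (s * a + c * b) ^+ 2 = (c ^+ 2 + s ^+ 2) * (a ^+ 2 + b ^+ 2) by ring.
by rewrite cs mul1r.
Qed.

Lemma gen_neq0 x : x != 0 -> g *m x != 0.
Proof.
move=> x0; apply/eqP => gx0; have := sqn_gt0 x0.
by rewrite -sqn_gen gx0 /sqn big1 ?ltxx // => i _; rewrite mxE expr0n.
Qed.

End LensCoordinates.

(** * Eigenfunctions of lens spaces as polynomials supported on the lattice *)

Section LensSpectrum.
Variables (R : realType) (n q : nat) (p : 'I_n -> int).
Hypothesis n_gt0 : (0 < n)%N.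
Hypothesis q_gt0 : (0 < q)%N.
Local Notation N := (\sum_(j < n) 2)%N.
Local Notation V := 'cV[R]_N.
Local Notation T := ('I_n * bool)%type.
Local Notation expo := {ffun T -> nat}.
Local Notation G := (lens_group R q p).
Local Notation g := (lens_generator R q p).
Local Notation L := (lens_lattice q p).
Local Notation hart := (hart (@ix n) (@iy n)).
Local Notation lc := (lc (@ix n) (@iy n)).
Local Notation ang := (@angle R n q p).
Implicit Types (x : V) (j : 'I_n) (al be : expo) (r : expo -> R) (k : nat).

(** The generator multiplies the complex monomial of exponent [al] by [exp (i theta)]. *)
Definition theta al : R := \sum_j ang j * ((al (j, false))%:R - (al (j, true))%:R).

Lemma theta_inc j c al : theta (inc (j, c) al) = theta al + (-1) ^+ c * ang j.
Proof.
rewrite /theta (bigD1 j) //= [in RHS](bigD1 j) //= !ffunE !xpair_eqE eqxx /= !natrD.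
rewrite (eq_bigr (fun i => ang i * ((al (i, false))%:R - (al (i, true))%:R))).
  by case: c; rewrite /= ?expr0 ?expr1; ring.
by move=> i /negbTE ij; rewrite !ffunE !xpair_eqE ij /= !addn0.
Qed.

Lemma theta_swap al : theta (swap al) = - theta al.
Proof.
rewrite /theta -sumrN; apply: eq_bigr => j _; rewrite !ffunE /=.
by rewrite -mulrN opprB.
Qed.

Lemma hart_gen al x :
  hart al (g *m x) = cos (theta al) * hart al x + sin (theta al) * hart (swap al) x.
Proof.
elim/expo_swap_ind: al => [|j c al IH1 IH2].
  have -> : theta [ffun=> 0%N] = 0.
    by rewrite /theta big1 // => j _; rewrite !ffunE subrr mulr0.
  by rewrite !hart0 cos0 sin0 mul0r mul1r addr0.
rewrite hart_inc IH1 IH2 swap_inc !hart_inc swapK theta_swap theta_inc genX genY.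
rewrite cosN sinN.
by case: c; rewrite /= ?expr0 ?expr1 ?mulN1r ?mul1r ?cosB ?sinB ?cosD ?sinD; ring.
Qed.

Lemma thetaE al : theta al = 2 * pi * (\sum_j wt al j 0 * p j)%:~R / q%:R.
Proof.
rewrite /theta rmorph_sum /= mulr_sumr mulr_suml; apply: eq_bigr => j _.
by rewrite mxE intrM intrB /angle; field; rewrite pnatr_eq0 -lt0n.
Qed.

Lemma cos_theta al : cos (theta al) = 1 <-> L (wt al).
Proof. by rewrite thetaE; exact: cos_2pi_dvd. Qed.

Lemma lc_gen k r x : lc k r (g *m x) =
  lc k (fun al => r al * cos (theta al) - r (swap al) * sin (theta al)) x.
Proof.
rewrite /lc; under eq_bigr do rewrite hart_gen mulrDr.
rewrite big_split /= -(sum_expos_swap _ (fun al => r al * (sin (theta al) * hart (swap al) x))).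
rewrite -big_split /=; apply: eq_bigr => al _.
by rewrite swapK theta_swap sinN; ring.
Qed.

Lemma punctured_nonempty : exists x : V, x != 0.
Proof.
exists (delta_mx (ix (Ordinal n_gt0)) 0); apply/eqP => /matrixP.
by move=> /(_ (ix (Ordinal n_gt0)) 0); rewrite !mxE !eqxx => /eqP; rewrite oner_eq0.
Qed.

Lemma lens_harmonic_lcP k r :
  harmonic (lc k r) <-> (forall be, (deg be).+2 = k -> lap_coef r be = 0).
Proof.
apply: harmonic_lcP punctured_nonempty.
- exact: ix_inj.
- exact: iy_inj.
- exact: ixy_neq.
- exact: sum_ixy.
Qed.

(** Invariance says that the pair [(r al, r (swap al))] is fixed by a rotation of angle [theta al].
    Outside L this rotation is not the identity, and its difference with the identity has
    determinant [2 (1 - cos (theta al))], which is nonzero. *)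
Lemma lc_invariant_supp k r : (forall x, x != 0 -> lc k r (g *m x) = lc k r x) ->
  forall al, deg al = k -> ~ L (wt al) -> r al = 0.
Proof.
move=> inv al ak nL.
pose r' be := r be * cos (theta be) - r (swap be) * sin (theta be).
have E : forall be, deg be = k -> r be = r' be.
  apply: (lc_inj (@ix_inj n) (@iy_inj n) (@ixy_neq n) punctured_nonempty) => x x0.
  by rewrite /r' -lc_gen inv.
have E1 := E al ak; have E2 := E (swap al); rewrite /r' in E1 E2; rewrite deg_swap swapK theta_swap cosN sinN in E2.
have {}E2 := E2 ak; have cs := cos2Dsin2 (theta al).
have c1 : cos (theta al) != 1 by apply/eqP => /cos_theta.
move: E1 E2 cs c1; move: (cos _) (sin _) (r al) (r (swap al)) => c s a b E1 E2 cs c1.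
have e1 : a * (1 - c) = - (b * s) by lra.
have e2 : b * (1 - c) = a * s by lra.
have : a * (2 * (1 - c)) = 0.
  have -> : 2 * (1 - c) = (1 - c) * (1 - c) + s ^+ 2 + (1 - (c ^+ 2 + s ^+ 2)) by ring.
  rewrite cs subrr addr0 mulrDr mulrA e1 mulNr mulrAC e2; ring.
move/eqP; rewrite !mulf_eq0 pnatr_eq0 /= subr_eq0 [1 == c]eq_sym (negbTE c1) orbF.
by move/eqP.
Qed.

Lemma lc_supp_invariant k r : (forall al, deg al = k -> ~ L (wt al) -> r al = 0) ->
  forall x, lc k r (g *m x) = lc k r x.
Proof.
move=> supp x; rewrite lc_gen; apply: lc_ext => al ak.
have [/cos_theta c1|nL] := pselect (L (wt al)).
  have s0 : sin (theta al) = 0 by apply: cos1sin0; rewrite c1 normr1.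
  by rewrite c1 s0 mulr0 subr0 mulr1.
(* [swap] changes the sign of [theta], and the cosine is even. *)
have nL' : ~ L (wt (swap al)).
  by rewrite -cos_theta theta_swap cosN cos_theta.
by rewrite (supp al) // (supp (swap al)) ?deg_swap // !mul0r subrr.
Qed.

(** A function of orbits takes equal values at [x] and [g *m x] on the sphere; as [g] preserves the
    norm, its homogeneous extension is invariant too, which restricts the exponents to L. *)
Lemma lens_eigen_lc lambda f : eigenfunction G lambda f ->
  (forall x, sphere x -> f (orbit_of G x) = 0) \/
  exists k r, [/\ lambda = sphere_eigenvalue R N k,
    forall be, (deg be).+2 = k -> lap_coef r be = 0,
    forall al, deg al = k -> ~ L (wt al) -> r al = 0 &
    forall x, sphere x -> f (orbit_of G x) = lc k r x].
Proof.
move=> Ef; have [|[k [u [lk Hu hu us]]]] := sphere_eigen_classify (lens_dim n_gt0) Ef.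
  by left.
right; have [r ur] := harmonic_poly (@sum_ixy R n) (lens_dim n_gt0) Hu hu.
have [su lu] := Hu; have pO := @punctured_open R N.
exists k, r; split => //.
- apply: (lens_harmonic_lcP k r).1; split; first by apply: (smooth_ext pO _ su) => x x0; exact: ur.
  by move=> x x0; rewrite -(lap_ext ur x0) lu.
- apply: lc_invariant_supp => x x0; have gx0 := gen_neq0 q p x0.
  rewrite -!ur // (homog_radial hu x0) (homog_radial hu gx0).
  have nE (s : R) : npow s (g *m x) = npow s x by rewrite /npow sqn_gen.
  rewrite nE -!us; try exact: radial_sphere.
  have -> : radial (g *m x) = g *m radial x by rewrite !radialE nE scalemxAr.
  by rewrite /= orbit_gen.
- by move=> x x1; rewrite -(ur x (sphere_neq0 x1)); exact: us.
Qed.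

Lemma lc_lens_eigen k r :
  (forall be, (deg be).+2 = k -> lap_coef r be = 0) ->
  (forall al, deg al = k -> ~ L (wt al) -> r al = 0) ->
  exists f, eigenfunction G (sphere_eigenvalue R N k) f /\
    forall x, f (orbit_of G x) = lc k r x.
Proof.
move=> lr supp.
(* The value at an orbit is read at a chosen point; invariance makes the choice irrelevant. *)
pose f (A : set V) := lc k r (get A).
have inv m x : lc k r (g ^+ m *m x) = lc k r x.
  elim: m => [|m IH]; first by rewrite expr0 mul1mx.
  have -> : g ^+ m.+1 *m x = g *m (g ^+ m *m x) by rewrite exprS mulmxA.
  by rewrite lc_supp_invariant.
have fE x : f (orbit_of G x) = lc k r x.
  have : orbit_of G x (get (orbit_of G x)).
    exact: (getI (orbit_self q p x)).
  by rewrite /f => -[_ [m _ <-] <-]; exact: inv.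
exists f; split => //.
have fo : f \o orbit_of G = lc k r by apply/funext => x; exact: fE.
have Hu : harmonic (lc k r).
  by apply/lens_harmonic_lcP.
have [E1 E2] := harmonic_sphere_eigen Hu (lc_homog _ _ k r).
split; first by rewrite /smooth_on_quotient fo.
by move=> x x1; rewrite fo -E2 // fE.
Qed.

End LensSpectrum.

(** * Counting lattice points *)

Section Counting.
Variables (n : nat) (j0 : 'I_n).
Local Notation T := ('I_n * bool)%type.
Local Notation expo := {ffun T -> nat}.
Local Notation mult := {ffun 'I_n -> nat}.
Implicit Types (al be : expo) (mu : mult) (j : 'I_n) (k t : nat) (L : set 'cV[int]_n).

(** Monomials without any factor [z_j zbar_j]; through [wt] and [of_vec] they correspond to integer
    vectors. *)
Definition reduced al : bool := [forall j, pairs j al == 0%N].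

Definition add_pairs mu al : expo := [ffun p => (al p + mu p.1)%N].
Definition all_pairs al : mult := [ffun j => pairs j al].
Definition reduce al : expo := [ffun p => (al p - pairs p.1 al)%N].

Lemma pairs_le al j c : (pairs j al <= al (j, c))%N.
Proof. by case: c; rewrite ?geq_minr ?geq_minl. Qed.

Lemma reduceK al : add_pairs (all_pairs al) (reduce al) = al.
Proof. by apply/ffunP => -[j c]; rewrite !ffunE /= subnK // pairs_le. Qed.

Lemma pairs_add mu al j : pairs j (add_pairs mu al) = (pairs j al + mu j)%N.
Proof. by rewrite /pairs !ffunE /= addn_minl. Qed.

Lemma reduced_reduce al : reduced (reduce al).
Proof.
by apply/forallP => j; apply/eqP; rewrite /pairs !ffunE /= /pairs; lia.
Qed.

Lemma all_pairs_add mu al : reduced al -> all_pairs (add_pairs mu al) = mu.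
Proof.
by move=> /forallP r; apply/ffunP => j; rewrite ffunE pairs_add (eqP (r j)).
Qed.

Lemma reduce_add mu al : reduced al -> reduce (add_pairs mu al) = al.
Proof.
move=> /forallP r; apply/ffunP => -[j c]; rewrite ffunE /= pairs_add (eqP (r j)) add0n.
by rewrite ffunE addnK.
Qed.

Lemma sum_pair_bool (F : T -> nat) : (\sum_p F p = \sum_j (F (j, false) + F (j, true)))%N.
Proof.
rewrite (eq_bigr (fun p : T => F (p.1, p.2))); last by case.
rewrite -(pair_bigA _ (fun j c => F (j, c))) /=.
by apply: eq_bigr => j _; rewrite big_bool addnC.
Qed.

Lemma deg_add mu al : deg (add_pairs mu al) = (deg al + (deg mu).*2)%N.
Proof.
rewrite /deg (eq_bigr (fun p : T => al p + mu p.1)%N); last by move=> p _; rewrite ffunE.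
rewrite big_split /= (sum_pair_bool (fun p => mu p.1)) /=; congr (_ + _)%N.
by rewrite big_split /= addnn.
Qed.

Lemma wt_add mu al : wt (add_pairs mu al) = wt al.
Proof. by apply/colP => j; rewrite !mxE !ffunE /= !PoszD; lra. Qed.

Definition reduced_exponents L k : seq expo := [seq al <- expos T k | reduced al && `[< L (wt al) >]].

(** This is [N_L(k)]: for a reduced exponent the degree is the 1-norm of the weight. *)
Definition shell L k : nat := size (reduced_exponents L k).

Definition basis_exponents L k : seq expo :=
  [seq al <- expos T k | (pairs j0 al == 0%N) && `[< L (wt al) >]].

(** The constant [c_t]. *)
Definition pair_choices t : nat := size [seq mu : mult <- expos 'I_n t | mu j0 == 0%N].

Lemma pair_choices0 : pair_choices 0 = 1%N.
Proof.
rewrite /pair_choices.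
have E : perm_eq [seq mu : mult <- expos 'I_n 0 | mu j0 == 0%N] [:: [ffun=> 0%N]].
  apply: uniq_perm => //; first exact/filter_uniq/expos_uniq.
  move=> mu; rewrite mem_filter mem_expos inE; apply/andP/eqP => [[_ /eqP /deg_eq0 //]|->].
  by rewrite ffunE deg0.
by rewrite (perm_size E).
Qed.

Lemma size_fiber L k t mu : deg mu = t -> (t.*2 <= k)%N ->
  size [seq al <- expos T k | (all_pairs al == mu) && `[< L (wt al) >]] = shell L (k - t.*2).
Proof.
move=> mt tk; rewrite /shell -[RHS](size_map (add_pairs mu)); apply: perm_size; apply: uniq_perm.
- exact/filter_uniq/expos_uniq.
- rewrite map_inj_in_uniq; first exact/filter_uniq/expos_uniq.
  move=> al be; rewrite !mem_filter => /andP[/andP[ra _] _] /andP[/andP[rb _] _] E.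
  by rewrite -(reduce_add mu ra) E reduce_add.
move=> al; rewrite mem_filter mem_expos; apply/andP/mapP.
- move=> [/andP[/eqP am La] /eqP ak]; exists (reduce al); last by rewrite -am reduceK.
  have E := reduceK al; rewrite am in E.
  rewrite mem_filter mem_expos reduced_reduce /= -(wt_add mu) E La /=.
  have dE := congr1 (@deg _) E; rewrite deg_add mt in dE.
  by rewrite -ak -dE addnK.
- move=> [be]; rewrite mem_filter mem_expos => /andP[/andP[rb Lb] /eqP bk] ->.
  by rewrite all_pairs_add // eqxx wt_add Lb deg_add bk mt subnK.
Qed.

Lemma deg_all_pairs al : ((deg (all_pairs al)).*2 <= deg al)%N.
Proof. by rewrite -{2}(reduceK al) deg_add leq_addl. Qed.

(** The exponents are sorted by their common part [mu] and by [t = deg mu]. The condition at [j0]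
    concerns only [mu], and each fiber is a shell of degree [k - 2t]; the guard excludes truncated
    subtraction. *)
Lemma size_basis L k : size (basis_exponents L k) =
  (\sum_(t < k.+1) (if t.*2 <= k then pair_choices t * shell L (k - t.*2) else 0))%N.
Proof.
pose P al t mu := (mu == all_pairs al) && (pairs j0 al == 0%N) && `[< L (wt al) >].
transitivity (\sum_(al <- expos T k) \sum_(t < k.+1) \sum_(mu <- expos 'I_n t) (P al t mu : nat))%N.
  rewrite size_filter -sum1_count big_mkcond /=; apply: eq_big_seq => al.
  rewrite mem_expos => /eqP ak.
  have tk : (deg (all_pairs al) < k.+1)%N.
    by rewrite ltnS -ak (leq_trans _ (deg_all_pairs al)) // -addnn leq_addr.
  rewrite (bigD1 (Ordinal tk)) //= [X in (_ + X)%N]big1 ?addn0; last first.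
    move=> t tne; apply: big1_seq => mu /=; rewrite mem_expos => /eqP mt.
    rewrite /P; case: eqP => // E; exfalso; move/eqP: tne; apply; apply: val_inj.
    by rewrite /= -mt E.
  rewrite (bigD1_seq (all_pairs al)) ?mem_expos ?expos_uniq //= big1 ?addn0.
    by rewrite /P eqxx /=; case: (_ && _).
  by move=> mu /negbTE ne; rewrite /P ne.
rewrite exchange_big /=; apply: eq_bigr => t _; rewrite exchange_big /=.
case: ifP => tk; last first.
  apply: big1_seq => mu /=; rewrite mem_expos => /eqP mt; apply: big1_seq => al /=.
  rewrite mem_expos => /eqP ak; rewrite /P; case: eqP => // E; exfalso.
  by have := deg_all_pairs al; rewrite -E mt ak tk.
rewrite /pair_choices size_filter -sum1_count [X in (_ = X * _)%N]big_mkcond /= big_distrl /=.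
apply: eq_big_seq => mu; rewrite mem_expos => /eqP mt.
case: ifP => m0; last first.
  rewrite mul0n; apply: big1 => al _; rewrite /P; case: eqP => // E.
  by move: m0; rewrite E ffunE => ->.
rewrite mul1n -(size_fiber L mt tk) size_filter -sum1_count [RHS]big_mkcond /=.
apply: eq_bigr => al _; rewrite /P eq_sym; case: eqP => // E.
have -> : pairs j0 al == 0%N by move: m0; rewrite -E ffunE.
by case: `[< _ >].
Qed.

(** The relation is triangular with diagonal coefficient [pair_choices 0 = 1], so strong induction
    recovers the shells. *)
Lemma shell_basis L1 L2 : (forall k, size (basis_exponents L1 k) = size (basis_exponents L2 k)) <->
  (forall k, shell L1 k = shell L2 k).
Proof.
split=> [E k|E k]; last first.
  by rewrite !size_basis; apply: eq_bigr => t _; rewrite E.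
elim/ltn_ind: k => k IH; have := E k; rewrite !size_basis !big_ord_recl /=.
rewrite pair_choices0 !mul1n subn0.
rewrite (eq_bigr (fun t : 'I_k => if ((bump 0 t).*2 <= k)%N then
   (pair_choices (bump 0 t) * shell L2 (k - (bump 0 t).*2))%N else 0%N)); first by move/addIn.
move=> t _; case: ifP => // tk; rewrite IH // -subSn // leq_subLR.
by rewrite /bump /= add1n doubleS -addn1 addnC leq_add2r.
Qed.

Definition of_vec (v : 'cV[int]_n) : expo :=
  [ffun p => if (v p.1 0 < 0) == p.2 then absz (v p.1 0) else 0%N].

Definition norm1 (v : 'cV[int]_n) : nat := (\sum_j absz (v j 0%R))%N.

Lemma of_vecK v : wt (of_vec v) = v.
Proof.
apply/colP => j; rewrite !mxE !ffunE /=; case: (ltP (v j 0) 0) => h /=; lia.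
Qed.

Lemma reduced_of_vec v : reduced (of_vec v).
Proof.
apply/forallP => j; rewrite /pairs !ffunE /=.
by case: (v j 0 < 0); rewrite ?min0n ?minn0.
Qed.

Lemma deg_of_vec v : deg (of_vec v) = norm1 v.
Proof.
rewrite /deg sum_pair_bool; apply: eq_bigr => j _; rewrite !ffunE /=.
by case: (v j 0 < 0); rewrite ?add0n ?addn0.
Qed.

Lemma wtK al : reduced al -> of_vec (wt al) = al.
Proof.
move=> /forallP r; apply/ffunP => -[j c]; rewrite !ffunE /= mxE.
have /eqP := r j; rewrite /pairs => m0.
by case: c; case: (ltP _ 0) => h /=; lia.
Qed.

End Counting.

(** * The Ehrhart function as a count of lattice vectors *)

Section Ehrhart.
Variables (R : realType) (n q : nat) (p : 'I_n -> int) (A : 'M[int]_n).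
Hypothesis q_gt0 : (0 < q)%N.
Hypothesis genA : generating_matrix (lens_lattice q p) A.
Local Notation L := (lens_lattice q p).
Local Notation T := ('I_n * bool)%type.
Local Notation expo := {ffun T -> nat}.
Local Notation AR := (map_mx intr A : 'M[R]_n).

Lemma lattice_mulmx c : L (A *m c).
Proof. by have [-> _] := genA; exists c. Qed.

Lemma lattice_coord v : L v -> exists c, A *m c = v.
Proof. by have [-> _] := genA; case=> c _ <-; exists c. Qed.

Lemma gen_inj (c d : 'cV[int]_n) : A *m c = A *m d -> c = d.
Proof.
move=> E; have [_ K] := genA; apply/eqP; rewrite -subr_eq0; apply/eqP/K.
by rewrite mulmxBr E subrr.
Qed.

Lemma scaled_basis_lattice j : L (q%:Z *: delta_mx j 0).
Proof.
rewrite /lens_lattice /= (bigD1 j) //= big1 => [|i /negbTE ij].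
  by rewrite !mxE !eqxx mulr1 addr0 mod0z modzMr.
by rewrite !mxE ij mulr0 mul0r.
Qed.

(** L contains [q Z^n], so [A *m D = q] for some integer matrix [D], and [D / q] is a right inverse
    over the reals. *)
Lemma generating_unit : AR \in unitmx.
Proof.
have H (j : 'I_n) : exists c : 'cV[int]_n, A *m c = q%:Z *: delta_mx j 0.
  exact: (lattice_coord (scaled_basis_lattice j)).
have [C HC] := choice H.
pose D : 'M[int]_n := \matrix_(i, j) C j i 0.
have AD : A *m D = q%:Z%:M.
  apply/matrixP => i j; have /matrixP /(_ i 0) := HC j; rewrite mxE => E.
  rewrite [LHS]mxE; under eq_bigr do rewrite mxE.
  by rewrite E !mxE eqxx andbT mulr_natr.
have ADR : AR *m ((q%:R)^-1 *: map_mx intr D) = 1%:M.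
  rewrite -scalemxAr -map_mxM AD map_scalar_mx scale_scalar_mx mulVf //.
  by rewrite pnatr_eq0 -lt0n.
by have [] := mulmx1_unit ADR.
Qed.

Lemma norm1_intr (v : 'cV[int]_n) : (norm1 v)%:R = \sum_i `|(map_mx intr v : 'cV[R]_n) i 0|.
Proof.
rewrite /norm1 natr_sum; apply: eq_bigr => i _.
by rewrite mxE -intr_norm -abszE.
Qed.

Lemma lattice_polytopeP m (z : 'cV[int]_n) :
  [set m%:R *: x | x in lattice_polytope R A] (map_mx intr z) <-> (norm1 (A *m z) <= m)%N.
Proof.
have U := generating_unit; split.
  move=> [_ [y y1 <-] E].
  have {}E : map_mx intr (A *m z) = m%:R *: y :> 'cV[R]_n.
    by rewrite map_mxM -E -scalemxAr mulKVmx.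
  rewrite -(ler_nat R) norm1_intr E.
  under eq_bigr do rewrite mxE normrM ger0_norm //.
  by rewrite -mulr_sumr ler_piMr.
move=> zm; exists (invmx AR *m (m%:R^-1 *: map_mx intr (A *m z))); last first.
  (* For [m = 0] the witness is 0, as the inverse of 0 is 0, so [z] must be 0; this follows from the
     norm bound and injectivity of [A]. *)
  have [m0|m0] := posnP m; last first.
    by rewrite -scalemxAr scalerA divff ?pnatr_eq0 -?lt0n // scale1r map_mxM mulKmx.
  have : norm1 (A *m z) = 0%N by apply/eqP; rewrite -leqn0 -{2}m0.
  move=> /eqP; rewrite sum_nat_eq0 => /forallP Az.
  have -> : z = 0.
    apply: gen_inj; rewrite mulmx0; apply/colP => i; rewrite [RHS]mxE.
    by apply/eqP; rewrite -absz_eq0; exact: (implyP (Az i)).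
  by rewrite m0 scale0r map_mx0.
exists (m%:R^-1 *: map_mx intr (A *m z)) => //; rewrite /cross_polytope /=.
under eq_bigr do rewrite mxE normrM ger0_norm ?invr_ge0 //.
rewrite -mulr_sumr -norm1_intr; have [->|m0] := posnP m; first by rewrite invr0 mul0r.
by rewrite mulrC ler_pdivrMr ?ltr0n // mul1r ler_nat.
Qed.

Definition lattice_preimage (al : expo) : 'cV[int]_n := xget 0 [set c | A *m c = wt al].

Lemma lattice_preimageE al : L (wt al) -> A *m lattice_preimage al = wt al.
Proof. by move=> /lattice_coord[c Ac]; exact: (@xgetI _ 0 [set c | A *m c = wt al] c Ac). Qed.

Lemma ehrhart_shell m : ehrhart R A m = (\sum_(k < m.+1) shell L k)%N.
Proof.
(* A list without repetition of the integer points of the dilated polytope, shell by shell. *)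
pose s := [seq lattice_preimage al | al <- flatten [seq reduced_exponents L k | k <- iota 0 m.+1]].
have mem_fl al : (al \in flatten [seq reduced_exponents L k | k <- iota 0 m.+1]) =
    [&& reduced al, `[< L (wt al) >] & (deg al <= m)%N].
  apply/flatten_mapP/and3P => [[k]|[ra La am]].
    rewrite mem_iota add0n /= ltnS => km; rewrite mem_filter mem_expos.
    by move=> /andP[/andP[-> ->] /eqP ->].
  by exists (deg al); rewrite ?mem_iota ?add0n ?ltnS // mem_filter ra La mem_expos /=.
have us : uniq s.
  rewrite map_inj_in_uniq.
    elim: (iota 0 m.+1) (iota_uniq 0 m.+1) => //= k l IH /andP[kl ul].
    rewrite cat_uniq IH // andbT filter_uniq ?expos_uniq //=.
    apply/hasPn => al /flatten_mapP[k' k'l]; rewrite mem_filter mem_expos => /andP[_ /eqP ak'].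
    apply/negP => h; have : al \in reduced_exponents L k by [].
    rewrite mem_filter mem_expos => /andP[_ /eqP ak]; move/negP: kl; apply.
    by rewrite -ak ak'.
  move=> al be; rewrite !mem_fl => /and3P[ra /asboolP La _] /and3P[rb /asboolP Lb _] E.
  by rewrite -(wtK ra) -(wtK rb) -(lattice_preimageE La) -(lattice_preimageE Lb) E.
have -> : ehrhart R A m = size s.
  rewrite /ehrhart; set S := [set z | _].
  have -> : S = [set` [fset z in s]%fset].
    apply/seteqP; split => z /=; rewrite inE.
      move=> /lattice_polytopeP zm; apply/mapP; exists (of_vec (A *m z)).
        rewrite mem_fl reduced_of_vec of_vecK deg_of_vec zm andbT /=.
        by apply/asboolP; exact: lattice_mulmx.
      apply: gen_inj; rewrite lattice_preimageE of_vecK //; exact: lattice_mulmx.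
    move=> /mapP[al]; rewrite mem_fl => /and3P[ra /asboolP La am ->].
    by apply/lattice_polytopeP; rewrite lattice_preimageE // -deg_of_vec wtK.
  by rewrite set_fsetK card_fseq undup_id.
rewrite size_map size_flatten /shape -map_comp sumnE big_map.
by rewrite -[iota 0 m.+1]/(index_iota 0 m.+1) big_mkord.
Qed.

End Ehrhart.

Lemma sum_shell_eq (f g : nat -> nat) :
  (forall m, (\sum_(k < m.+1) f k = \sum_(k < m.+1) g k)%N) <-> (forall k, f k = g k).
Proof.
split=> [E [|k]|E m]; last by apply: eq_bigr => k _.
  by have := E 0%N; rewrite !big_ord1.
have := E k.+1; rewrite big_ord_recr [RHS]big_ord_recr /= E.
by move/addnI.
Qed.

(** * Uniqueness of multiplicities *)

Section Multiplicity.
Variables (R : realType) (N : nat) (G : set 'M[R]_N).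

(** Expressing each basis in the other gives matrices with [P *m Q = 1] by independence, whence
    [m <= m']; the roles are then exchanged. *)
Lemma multiplicity_unique (lambda : R) m1 m2 :
  has_multiplicity G lambda m1 -> has_multiplicity G lambda m2 -> m1 = m2.
Proof.
suff H m m' : has_multiplicity G lambda m -> has_multiplicity G lambda m' -> (m <= m')%N.
  by move=> h1 h2; apply/eqP; rewrite eqn_leq (H _ _ h1 h2) (H _ _ h2 h1).
move=> [b [eb ib sb]] [b' [eb' _ sb']].
have [P HP] := choice (fun i => sb' (b i) (eb i)).
have [Q HQ] := choice (fun j => sb (b' j) (eb' j)).
apply: (@mulmx1_min R m m' (\matrix_(i, j) P i j) (\matrix_(j, i) Q j i)).
apply/matrixP => i k; rewrite !mxE.
under eq_bigr do rewrite !mxE.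
apply/eqP; rewrite -subr_eq0; apply/eqP.
apply: (ib (fun k => \sum_j P i j * Q j k - (i == k)%:R)) => X SX.
under eq_bigr do rewrite mulrBl.
rewrite sumrB (bigD1 i (F := fun k => (i == k)%:R * b k X)) //= eqxx mul1r.
rewrite [X in _ - (_ + X)]big1 ?addr0; last first.
  by move=> l /negbTE il; rewrite eq_sym il mul0r.
rewrite (HP i X SX); apply/eqP; rewrite subr_eq0; apply/eqP.
under eq_bigr do rewrite mulr_suml.
rewrite exchange_big /=; apply: eq_bigr => j _.
rewrite (HQ j X SX) mulr_sumr; apply: eq_bigr => l _.
by rewrite mulrA.
Qed.

Lemma multiplicity0 (lambda : R) :
  (forall f, eigenfunction G lambda f -> forall X, sphere_quotient G X -> f X = 0) ->
  has_multiplicity G lambda 0.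
Proof.
move=> z; exists (fun i : 'I_0 => let: Ordinal _ h := i in match notF h with end).
split; [by case | by move=> c _; case | ].
move=> f ef; exists (fun=> 0) => X SX; rewrite big_ord0; exact: z ef X SX.
Qed.

End Multiplicity.

(** * Multiplicities of lens spaces *)

Section LensMultiplicity.
Variables (R : realType) (n q : nat) (p : 'I_n -> int).
Hypothesis n_gt0 : (0 < n)%N.
Hypothesis q_gt0 : (0 < q)%N.
Local Notation N := (\sum_(j < n) 2)%N.
Local Notation V := 'cV[R]_N.
Local Notation T := ('I_n * bool)%type.
Local Notation expo := {ffun T -> nat}.
Local Notation G := (lens_group R q p).
Local Notation L := (lens_lattice q p).
Local Notation lc := (lc (@ix n) (@iy n)).
Local Notation j0 := (Ordinal n_gt0).

(** Strict monotonicity, from [N >= 2]. Different degrees never share an eigenvalue, so an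
    eigenspace consists of polynomials of a single degree. *)
Lemma sphere_eigenvalue_inj : injective (sphere_eigenvalue R N).
Proof.
have b0 : 0 <= N%:R - 2 :> R.
  rewrite subr_ge0 (ler_nat R 2); case: (lens_dim n_gt0) => [->//|].
  by apply: ltn_trans.
have H k l : (k < l)%N -> sphere_eigenvalue R N k < sphere_eigenvalue R N l.
  move=> kl; rewrite /sphere_eigenvalue -!addrA.
  have k0 : 0 <= k%:R :> R by rewrite ler0n.
  have kl' : k%:R < l%:R :> R by rewrite ltr_nat.
  move: b0 k0 kl'; move: (N%:R - 2) (k%:R) (l%:R) => b x y b0 x0 xy.
  by nra.
move=> k l E; case: (ltngtP k l) => // /H; by rewrite E ltxx.
Qed.

Lemma lc_sphere_eq0 k (r : expo -> R) : (forall x : V, sphere x -> lc k r x = 0) ->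
  forall al, deg al = k -> r al = 0.
Proof.
move=> z; apply: (lc_eq0 (@ix_inj n) (@iy_inj n) (@ixy_neq n) (punctured_nonempty R n_gt0)) => x x0.
by rewrite (homog_radial (lc_homog _ _ k r) x0) z ?mulr0 //; exact: radial_sphere.
Qed.

Lemma lens_multiplicity k :
  has_multiplicity G (sphere_eigenvalue R N k) (size (basis_exponents j0 L k)).
Proof.
pose gd := basis_exponents j0 L k.
have gdP al : (al \in gd) = [&& pairs j0 al == 0%N, `[< L (wt al) >] & deg al == k].
  by rewrite mem_filter mem_expos -andbA.
pose be (i : 'I_(size gd)) := nth [ffun=> 0%N] gd i.
have be_gd i : be i \in gd by rewrite mem_nth.
have gd_uniq : uniq gd by exact/filter_uniq/expos_uniq.
(* The harmonic polynomial whose free coefficients are 1 at [be i] and 0 elsewhere: independence is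
   read off on the free coefficients. *)
pose r i : expo -> R := hext j0 (fun al => (al == be i)%:R).
have r_free i al : pairs j0 al = 0%N -> r i al = (al == be i)%:R by exact: hext_free.
have r_supp i al : ~ L (wt al) -> r i al = 0.
  apply: (@hext_supp _ _ _ _ L) => {}al nL; case: eqP => // E.
  by have := be_gd i; rewrite -E gdP => /and3P[_ /asboolP].
have [b Hb] := choice (fun i => lc_lens_eigen n_gt0 q_gt0
  (fun al (_ : (deg al).+2 = k) => hext_harmonic j0 (fun al => (al == be i)%:R) al)
  (fun al (_ : deg al = k) => r_supp i al)).
have bE i x : b i (orbit_of G x) = lc k (r i) x by have [_ ->] := Hb i.
have comb (c : 'I_(size gd) -> R) x : \sum_i c i * b i (orbit_of G x) =
    lc k (fun al => \sum_i c i * r i al) x.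
  by rewrite lc_sum; apply: eq_bigr => i _; rewrite lcZ bE.
exists b; split; first by move=> i; have [] := Hb i.
- move=> c z i.
  have bi := be_gd i; rewrite gdP in bi; case/and3P: bi => /eqP fi _ /eqP di.
  have : \sum_l c l * r l (be i) = 0.
    apply: (@lc_sphere_eq0 k (fun al => \sum_l c l * r l al)) di => x x1.
    by rewrite -comb; apply: z; exists x.
  rewrite (bigD1 i) //= r_free // eqxx mulr1 big1 ?addr0 // => l li.
  by rewrite r_free // nth_uniq // eq_sym (inj_eq val_inj) (negbTE li) mulr0.
- move=> f ef; have [z|[k' [r' [/sphere_eigenvalue_inj kk lr' sr' fr']]]] := lens_eigen_lc n_gt0 q_gt0 ef.
    by exists (fun=> 0) => _ [x x1 <-]; rewrite z // big1 // => i _; rewrite mul0r.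
  (* The coordinates of an eigenfunction are its own free coefficients, which determine a harmonic
     polynomial by [hext_unique]. *)
  subst k'; exists (fun i => r' (be i)) => _ [x x1 <-].
  rewrite fr' // comb; apply: lc_ext.
  apply: (hext_unique (j0 := j0)) => //.
    move=> al ak; rewrite /lap_coef.
    under eq_bigr do rewrite mulr_sumr.
    rewrite exchange_big /= big1 // => i _.
    under eq_bigr do rewrite mulrCA.
    by rewrite -mulr_sumr -/(lap_coef (r i) al) hext_harmonic mulr0.
  move=> al ak fa.
  under eq_bigr do rewrite r_free //.
  have [La|nL] := pselect (L (wt al)); last first.
    rewrite sr' // big1 // => i _; case: eqP => [E|_]; last by rewrite mulr0.
    by have := be_gd i; rewrite -E gdP => /and3P[_ /asboolP].
  have al_gd : al \in gd by rewrite gdP fa ak !eqxx asboolT.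
  have ai : (index al gd < size gd)%N by rewrite index_mem.
  have bei : be (Ordinal ai) = al by rewrite /be nth_index.
  rewrite (bigD1 (Ordinal ai)) //= bei eqxx mulr1 big1 ?addr0 // => l ll.
  by rewrite -bei nth_uniq // eq_sym (inj_eq val_inj) (negbTE ll) mulr0.
Qed.

Lemma lens_multiplicity_none lambda : (forall k, lambda <> sphere_eigenvalue R N k) ->
  has_multiplicity G lambda 0.
Proof.
move=> nl; apply: multiplicity0 => f ef _ [x x1 <-].
have [z|[k [r [lk _ _ _]]]] := lens_eigen_lc n_gt0 q_gt0 ef; first exact: z.
by have := nl k lk.
Qed.

End LensMultiplicity.

(** The list of candidate eigenvalues depends only on [n], so the two spectra are compared degree by
    degree; off this list both multiplicities are 0. *)
Lemma isospectral_basis (R : realType) (n q1 q2 : nat) (p1 p2 : 'I_n -> int) (n_gt0 : (0 < n)%N) :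
  (0 < q1)%N -> (0 < q2)%N ->
  isospectral (lens_group R q1 p1) (lens_group R q2 p2) <->
  (forall k, size (basis_exponents (Ordinal n_gt0) (lens_lattice q1 p1) k) =
             size (basis_exponents (Ordinal n_gt0) (lens_lattice q2 p2) k)).
Proof.
move=> hq1 hq2; split=> [iso k|E lambda m].
  have M1 := lens_multiplicity R p1 n_gt0 hq1 k.
  apply: multiplicity_unique (lens_multiplicity R p2 n_gt0 hq2 k).
  exact/iso.
have [[k ->]|nl] := pselect (exists k, lambda = sphere_eigenvalue R (\sum_(j < n) 2)%N k).
  have M1 := lens_multiplicity R p1 n_gt0 hq1 k.
  have M2 := lens_multiplicity R p2 n_gt0 hq2 k.
  split=> M; first by rewrite (multiplicity_unique M M1) E.
  by rewrite (multiplicity_unique M M2) -E.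
have nl' k : lambda <> sphere_eigenvalue R (\sum_(j < n) 2)%N k by move=> lk; apply: nl; exists k.
have M1 := lens_multiplicity_none p1 n_gt0 hq1 nl'.
have M2 := lens_multiplicity_none p2 n_gt0 hq2 nl'.
split=> M; first by rewrite (multiplicity_unique M M1).
by rewrite (multiplicity_unique M M2).
Qed.

Theorem theorem4p5 (R : realType) (n : nat) (hn : (0 < n)%N)
  (q1 q2 : nat) (p1 p2 : 'I_n -> int)
  (hq1 : (0 < q1)%N) (hq2 : (0 < q2)%N)
  (hp1 : forall j, coprimez (p1 j) (Posz q1))
  (hp2 : forall j, coprimez (p2 j) (Posz q2))
  (A B : 'M[int]_n)
  (hA : generating_matrix (lens_lattice q1 p1) A)
  (hB : generating_matrix (lens_lattice q2 p2) B) :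
  isospectral (lens_group R q1 p1) (lens_group R q2 p2) <->
  (forall m : nat, ehrhart R A m = ehrhart R B m).
Proof.
apply: iff_trans (isospectral_basis R p1 p2 hn hq1 hq2) _.
apply: iff_trans (shell_basis _ _ _) _.
apply: iff_trans (iff_sym (sum_shell_eq _ _)) _.
split=> E m; have := E m; rewrite !(ehrhart_shell R hq1 hA) !(ehrhart_shell R hq2 hB); exact.
Qed.
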